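(* Let $u\in W^{2,1}(0,T;\check H^2)$ with $u_0:=u(\cdot,0)\in\check H^2$ and $\hat u_0:=\partial_tu(\cdot,0)\in\check H^2$, let $V_hu$ be the Ritz–Volterra projection of $u$, and let $\rho:=V_hu-u$. Then there is a constant $Q>0$, independent of $h$, $u$ and $t$, such that for $0\le t\le T$ $$\|\partial_t^2\rho\|_{L^1(0,t;L^2)}+h\,\|\partial_t^2\rho\|_{L^1(0,t;\check H^1)}\le Qh^2\left(\|u_0\|_{\check H^2}+\|\hat u_0\|_{\check H^2}+\|u\|_{W^{2,1}(0,t;\check H^2)}\right).$$
   Context: $\Omega\subset\mathbb R^d$ ($1\le d\le 3$) is a simply connected bounded domain with piecewise smooth boundary $\partial\Omega$ and convex corners; $K>0$ and $T>0$ are constants. Standing assumption on the variable order $\alpha$: $0\le\alpha(t)\le\alpha^*<1$, $|\alpha'(t)|,|\alpha''(t)|\le Q_*$ on $[0,T]$ for constants $\alpha^*,Q_*$, and $\alpha(0)=\alpha'(0)=0$. The kernel is $$k(t):=\frac{d}{dt}\left(\frac{t^{-\alpha(t)}}{\Gamma(1-\alpha(t))}\right),\quad 0<t\le T,$$ extended by continuity to $t=0$. Let $\{\lambda_i^2,\phi_i\}_{i\ge1}$ ($\lambda_i>0$) be the eigenpairs of $-K\Delta$ with homogeneous Dirichlet boundary conditions, $\{\phi_i\}$ an orthonormal basis of $L^2(\Omega)$, $\{\lambda_i^2\}$ positive and non-decreasing. For $s\ge0$, $\check H^s:=\{q\in L^2(\Omega):\|q\|_{\check H^s}^2:=\sum_i\lambda_i^{2s}(q,\phi_i)^2<\infty\}$;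 $\check H^2=H^2(\Omega)\cap H_0^1(\Omega)$. Bochner–Sobolev spaces $W^{m,p}(0,t;X)$ have standard norms, and $L^2$ as a target space means $L^2(\Omega)$. Let $S_h\subset H_0^1(\Omega)$ be the space of continuous piecewise linear functions (vanishing on $\partial\Omega$) on a quasi-uniform partition of $\Omega$ with mesh parameter $h$, and $a(u,\chi):=(K\nabla u,\nabla\chi)$. The Ritz projection $R_h:H_0^1(\Omega)\to S_h$, defined by $a(u-R_hu,\chi_h)=0$ for all $\chi_h\in S_h$, satisfies $\|u-R_hu\|+h\|u-R_hu\|_{H^1}\le Qh^2\|u\|_{H^2}$ for $u\in H^2(\Omega)\cap H_0^1(\Omega)$, where $\|\cdot\|$ is the $L^2(\Omega)$ norm. The Ritz–Volterra projection $V_h:L^1(0,T;H_0^1)\to L^1(0,T;S_h)$ is defined by $$a((V_hu-u)(t),\chi_h)+\int_0^tk(t-s)\,a((V_hu-u)(s),\chi_h)\,ds=0,\quad\forall\chi_h\in S_h.$$ *)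

(* Defs.v *)
From HB Require Import structures.
From mathcomp Require Import all_boot all_order all_algebra.
From mathcomp Require Import all_classical all_reals all_analysis.
Set Implicit Arguments.
Unset Strict Implicit.
Unset Printing Implicit Defensive.
Import Order.TTheory GRing.Theory Num.Theory.
Import numFieldNormedType.Exports.
Local Open Scope classical_set_scope.
Local Open Scope ring_scope.

Section Kernel.
Context {R : realType}.

(* Derivative of [f] relative to [D]: one-sided at the endpoints of [D]. *)
Definition diff_quotient (f : R -> R) (t : R) : R -> R :=
  fun s => (f s - f t) / (s - t).

Definition derivable_in (D : set R) (f : R -> R) (t : R) : Prop :=
  cvg (diff_quotient f t @ within D t^').

Definition deriv_in (D : set R) (f : R -> R) (t : R) : R :=
  lim (diff_quotient f t @ within D t^').

Definition Gamma (x : R) : R :=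
  Rintegral lebesgue_measure `]0, +oo[ (fun s : R => s `^ (x - 1) * expR (- s)).

Definition variable_order (T : R) (alpha : R -> R) (astar Qstar : R) : Prop :=
  let I := [set` `[0, T]] in
  let alpha1 := deriv_in I alpha in
  let alpha2 := deriv_in I alpha1 in
  [/\ astar < 1,
      forall t, I t -> 0 <= alpha t <= astar,
      forall t, I t -> derivable_in I alpha t /\ derivable_in I alpha1 t,
      forall t, I t -> `|alpha1 t| <= Qstar /\ `|alpha2 t| <= Qstar
    & alpha 0 = 0 /\ alpha1 0 = 0].

Definition vo_kernel_pos (T : R) (alpha : R -> R) (t : R) : R :=
  deriv_in `]0, T] (fun s => s `^ (- alpha s) / Gamma (1 - alpha s)) t.

(* The value at 0 is the extension by continuity. *)
Definition vo_kernel (T : R) (alpha : R -> R) (t : R) : R :=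
  if t == 0 then lim (vo_kernel_pos T alpha s @[s --> 0^'+])
  else vo_kernel_pos T alpha t.

End Kernel.

(* The target space is a linear subset [X] of [V] with a seminorm [N]; two
  elements at [N]-distance 0 are the same point of the target.  Elements of
  L^1 are handled through representatives that are strongly measurable
  everywhere on the interval; every class contains one. *)

Section Bochner.
Context {R : realType} {V : lmodType R}.
Variables (X : set V) (N : V -> R).

Record simple_fun := SimpleFun {
  sf_card : nat;
  sf_set : 'I_sf_card -> set R;
  sf_val : 'I_sf_card -> V;
  sf_measurable : forall i, measurable (sf_set i);
  sf_valP : forall i, X (sf_val i) }.

Definition sf_eval (s : simple_fun) (t : R) : V :=
  \sum_(i < sf_card s) (\1_(sf_set i) t : R) *: sf_val i.

Definition sf_integral (D : set R) (s : simple_fun) : V :=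
  \sum_(i < sf_card s)
    fine (lebesgue_measure (sf_set i `&` D)) *: sf_val i.

Definition strongly_measurable (D : set R) (f : R -> V) : Prop :=
  exists s : nat -> simple_fun,
    forall t, D t -> (fun n => N (f t - sf_eval (s n) t)) @ \oo --> (0 : R).

Definition L1norm (D : set R) (f : R -> V) : \bar R :=
  (\int[lebesgue_measure]_(t in D) (N (f t))%:E)%E.

Definition L1 (D : set R) (f : R -> V) : Prop :=
  [/\ forall t, D t -> X (f t), strongly_measurable D f
    & (L1norm D f < +oo)%E].

(* [I] is the Bochner integral of [f] over the bounded interval [D]. *)
Definition is_bochner_integral (D : set R) (f : R -> V) (I : V) : Prop :=
  X I /\ (forall t, D t -> X (f t)) /\ exists s : nat -> simple_fun,
    ((fun n => L1norm D (fun t => f t - sf_eval (s n) t)) @ \oo --> (0 : R)%:E)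
    /\ ((fun n => N (sf_integral D (s n) - I)) @ \oo --> (0 : R)).

Definition time_test (T : R) (phi : R -> R) : Prop :=
  (forall n t, derivable (derive1n n phi) t 1) /\
  exists a b, [/\ 0 < a, b < T & forall t, ~ (a <= t <= b) -> phi t = 0].

(* [g] is the weak derivative of [f] on (0, T). *)
Definition weak_deriv (T : R) (f g : R -> V) : Prop :=
  forall phi, time_test T phi -> exists I : V,
    is_bochner_integral `]0, T[ (fun t => derive1 phi t *: f t) I /\
    is_bochner_integral `]0, T[ (fun t => phi t *: g t) (- I).

(* [u] is in W^{2,1}(0, T; X), with weak derivatives [u1] and [u2]. *)
Definition W21 (T : R) (u u1 u2 : R -> V) : Prop :=
  let D := [set` `]0, T[] in
  [/\ L1 D u, L1 D u1, L1 D u2, weak_deriv T u u1 & weak_deriv T u1 u2].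

Definition W21norm (t : R) (u u1 u2 : R -> V) : \bar R :=
  let D := [set` `]0, t[] in (L1norm D u + L1norm D u1 + L1norm D u2)%E.

(* [x] is the value at t = 0 of the continuous representative of [f]. *)
Definition initial_value (T : R) (f : R -> V) (x : V) : Prop :=
  X x /\ exists w : R -> V,
    (forall t, 0 < t < T -> X (w t)) /\
    {ae lebesgue_measure, forall t, 0 < t < T -> N (f t - w t) = 0} /\
    N (w t - x) @[t --> 0^'+] --> (0 : R).

End Bochner.

Section Geometry.
Context {R : realType} {d : nat}.
Local Notation E := 'rV[R]_d.

Fixpoint Ck (n : nat) (f : E -> R) : Prop :=
  continuous f /\
  if n is n'.+1 then
    forall i : 'I_d, (forall x, derivable f x (delta_mx 0 i)) /\
                     Ck n' (fun x => 'D_(delta_mx 0 i) f x)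
  else True.

Definition smooth (f : E -> R) : Prop := forall n, Ck n f.

Definition simply_connected (Omega : set E) : Prop :=
  forall gamma : R -> E,
    {within `[0, 1], continuous gamma} ->
    (forall s, 0 <= s <= 1 -> Omega (gamma s)) -> gamma 0 = gamma 1 ->
    exists H : R * R -> E,
      [/\ {within `[0, 1] `*` `[0, 1], continuous H},
          forall p, (`[0, 1] `*` `[0, 1]) p -> Omega (H p),
          forall s, 0 <= s <= 1 -> H (0, s) = gamma s
        & forall s, 0 <= s <= 1 ->
            [/\ H (1, s) = gamma 0, H (s, 0) = gamma 0 & H (s, 1) = gamma 0]].

Definition boundary (Omega : set E) : set E := closure Omega `\` Omega.

(* The boundary of an open set is a finite union of closed pieces of smooth
   hypersurfaces. *)
Definition piecewise_smooth_boundary (Omega : set E) : Prop :=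
  exists (m : nat) (G : 'I_m -> set E) (g : 'I_m -> E -> R),
    boundary Omega = \bigcup_j G j /\
    forall j, [/\ closed (G j), smooth (g j)
      & forall x, G j x -> g j x = 0 /\ exists v, 'D_v (g j) x != 0].

(* Near each boundary point the domain is an intersection of finitely many C^1
   half-spaces whose tangent half-spaces have a common interior direction: its
   tangent cone is convex with nonempty interior.  A single half-space gives
   a C^1 boundary point. *)
Definition convex_corners (Omega : set E) : Prop :=
  forall x0, boundary Omega x0 ->
    exists (m : nat) (g : 'I_m -> E -> R),
      [/\ forall j, Ck 1 (g j) /\ g j x0 = 0,
          exists v, forall j, 'D_v (g j) x0 < 0
        & \forall x \near x0, Omega x <-> forall j, g j x < 0].

Definition admissible_domain (Omega : set E) : Prop :=
  [/\ open Omega, Omega !=set0, bounded_set Omega, connected Omega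
    & [/\ simply_connected Omega, piecewise_smooth_boundary Omega
        & convex_corners Omega]].

Definition enorm (x : E) : R := Num.sqrt (\sum_i (x ord0 i) ^+ 2).

(* A simplex is given by the matrix whose rows are its vertices. *)
Local Notation simplex := 'M[R]_(d.+1, d).

Definition face (K : simplex) (J : {set 'I_d.+1}) : set E :=
  [set x | exists w : 'rV[R]_d.+1,
    [/\ forall j, 0 <= w ord0 j, forall j, j \notin J -> w ord0 j = 0,
        \sum_j w ord0 j = 1 & x = w *m K]].

Definition hull (K : simplex) : set E := face K [set: 'I_d.+1]%SET.

Definition mesh_region (M : seq simplex) : set E :=
  [set x | exists2 K, K \in M & hull K x].

Definition conforming (M : seq simplex) : Prop :=
  forall K K', K \in M -> K' \in M ->
    hull K `&` hull K' = face K [set j | [exists j', row j K == row j' K']]%SET.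

(* The longest edge of the mesh has length [h]. *)
Definition mesh_size (M : seq simplex) (h : R) : Prop :=
  (forall K i j, K \in M -> enorm (row i K - row j K) <= h) /\
  exists K i j, K \in M /\ enorm (row i K - row j K) = h.

(* The inradii are at least [c * h].  The simplices may miss a layer of width
   [C * h ^ 2] along the boundary, so that a curved boundary is allowed; for an
   exact partition of a polyhedral domain the layer is empty. *)
Definition quasi_uniform_partitions (Omega : set E) (I : Type)
    (M : I -> seq simplex) (h : I -> R) : Prop :=
  exists c C : R, 0 < c /\ 0 < C /\ forall i,
    [/\ 0 < h i, conforming (M i), mesh_size (M i) (h i),
        forall K, K \in M i -> exists z, forall x,
          enorm (x - z) < c * h i -> hull K x
      & mesh_region (M i) `<=` closure Omega /\
        forall x, Omega x -> ~ mesh_region (M i) x ->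
          exists2 y, boundary Omega y & enorm (x - y) <= C * h i ^+ 2].

End Geometry.

Notation borel_rV R d := (g_sigma_algebraType (@open 'rV[R]_d)).

(* Lebesgue measure on the Borel sets is the only measure with these values on
   boxes. *)
Definition is_lebesgue {R : realType} {d : nat}
    (mu : {measure set (borel_rV R d) -> \bar R}) : Prop :=
  forall a b : 'rV[R]_d, (forall i, a ord0 i <= b ord0 i) ->
    mu [set x : 'rV[R]_d | forall i, a ord0 i <= x ord0 i <= b ord0 i]
    = (\prod_i (b ord0 i - a ord0 i))%:E.

Section Spaces.
Context {R : realType} {d : nat}.
Local Notation E := 'rV[R]_d.
Variables (mu : {measure set (borel_rV R d) -> \bar R}) (Omega : set E).

(* Functions on [Omega] are represented by functions on the whole space, whose
   values outside [Omega] play no role. *)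
Definition L2 (f : E -> R) : Prop :=
  measurable_fun (Omega : set (borel_rV R d)) (f : borel_rV R d -> R) /\
  (\int[mu]_(x in Omega) ((f x) ^+ 2)%:E < +oo)%E.

Definition ip (f g : E -> R) : R := Rintegral mu Omega (fun x => f x * g x).

Definition L2norm (f : E -> R) : R := Num.sqrt (ip f f).

Definition test (phi : E -> R) : Prop :=
  smooth phi /\ exists A : set E,
    [/\ compact A, A `<=` Omega & forall x, ~ A x -> phi x = 0].

Definition weak_partial (i : 'I_d) (f g : E -> R) : Prop :=
  L2 g /\ forall phi, test phi ->
    ip f (fun x => 'D_(delta_mx 0 i) phi x) = - ip g phi.

(* The weak partial derivative, where it exists in L^2. *)
Definition wpartial (i : 'I_d) (f : E -> R) : E -> R := get (weak_partial i f).

Definition H1 (f : E -> R) : Prop :=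
  L2 f /\ forall i, exists g, weak_partial i f g.

Definition H1norm (f : E -> R) : R :=
  Num.sqrt (L2norm f ^+ 2 + \sum_i L2norm (wpartial i f) ^+ 2).

Definition H2 (f : E -> R) : Prop := H1 f /\ forall i, H1 (wpartial i f).

Definition H2norm (f : E -> R) : R :=
  Num.sqrt (L2norm f ^+ 2 + \sum_i L2norm (wpartial i f) ^+ 2
    + \sum_i \sum_j L2norm (wpartial j (wpartial i f)) ^+ 2).

Definition H10 (f : E -> R) : Prop :=
  H1 f /\ exists phi : nat -> E -> R,
    (forall n, test (phi n)) /\
    (fun n => H1norm (phi n - f)) @ \oo --> (0 : R).

Variable K : R.

Definition aform (u v : E -> R) : R :=
  K * \sum_i ip (wpartial i u) (wpartial i v).

(* (lam i ^ 2, phi i) are the Dirichlet eigenpairs of - K Laplacian, the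
   eigenvalue problem being read in its weak form. *)
Definition dirichlet_eigenpairs (lam : nat -> R) (phi : nat -> E -> R) : Prop :=
  [/\ forall i, 0 < lam i,
      forall i j, (i <= j)%N -> lam i ^+ 2 <= lam j ^+ 2,
      forall i, H10 (phi i) /\
        forall v, H10 v -> aform (phi i) v = lam i ^+ 2 * ip (phi i) v,
      forall i j, ip (phi i) (phi j) = (i == j)%:R
    & forall f, L2 f ->
        (fun n => L2norm (f - \sum_(i < n) ip f (phi i) *: phi i)) @ \oo
          --> (0 : R)].

Variables (lam : nat -> R) (phi : nat -> E -> R).

Definition Hdot_sqnorm (s : R) (q : E -> R) : \bar R :=
  (\sum_(0 <= i <oo) (lam i `^ (2 * s) * ip q (phi i) ^+ 2)%:E)%E.

Definition Hdot (s : R) (q : E -> R) : Prop :=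
  L2 q /\ (Hdot_sqnorm s q < +oo)%E.

Definition Hdot_norm (s : R) (q : E -> R) : R :=
  Num.sqrt (fine (Hdot_sqnorm s q)).

(* Equality of normed spaces: same elements, equivalent norms. *)
Definition Hdot2_eq_H2_H10 : Prop :=
  (forall q, Hdot 2 q <-> H2 q /\ H10 q) /\
  exists2 C : R, 0 < C & forall q, Hdot 2 q ->
    H2norm q <= C * Hdot_norm 2 q /\ Hdot_norm 2 q <= C * H2norm q.

(* Continuous piecewise linear functions on the mesh that vanish on the boundary
   (and on the part of the domain not covered by the simplices). *)
Definition Sh (M : seq 'M[R]_(d.+1, d)) (chi : E -> R) : Prop :=
  [/\ H10 chi, continuous chi,
      forall S, S \in M -> exists (b : R) (c : 'cV[R]_d),
        forall x, hull S x -> chi x = b + (x *m c) ord0 ord0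
    & forall x, ~ (Omega x /\ mesh_region M x) -> chi x = 0].

Definition is_ritz (M : seq 'M[R]_(d.+1, d)) (P : (E -> R) -> (E -> R)) : Prop :=
  forall u, H10 u ->
    Sh M (P u) /\ forall chi, Sh M chi -> aform (u - P u) chi = 0.

Definition ritz_estimate (I : Type) (h : I -> R)
    (P : I -> (E -> R) -> (E -> R)) : Prop :=
  exists2 Q : R, 0 < Q & forall i u, H2 u -> H10 u ->
    L2norm (u - P i u) + h i * H1norm (u - P i u) <= Q * h i ^+ 2 * H2norm u.

Definition is_ritz_volterra (M : seq 'M[R]_(d.+1, d)) (T : R) (k : R -> R)
    (u v : R -> E -> R) : Prop :=
  L1 (Sh M) H1norm `]0, T[ v /\
  {ae lebesgue_measure, forall t, 0 < t < T -> forall chi, Sh M chi ->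
    aform (v t - u t) chi
    + Rintegral lebesgue_measure `]0, t[
        (fun s => k (t - s) * aform (v s - u s) chi) = 0}.

End Spaces.

(* Main.v *)
Require Import Defs.
From mathcomp Require Import all_boot all_order all_algebra.
From mathcomp Require Import all_classical all_reals all_analysis.
From mathcomp Require Import measurable_realfun ring lra.
Import Order.TTheory GRing.Theory Num.Theory.
Import numFieldNormedType.Exports.
Local Open Scope classical_set_scope.
Local Open Scope ring_scope.

(**
The kernel is scalar and the same form [a] appears in both terms of the
Ritz-Volterra equation, so the projection is the Ritz projection: for a fixed
[chi] in [S_h] the function [g t = a((V_h u - R_h u)(t), chi)] satisfies
[g + k * g = 0], and [g = 0] almost everywhere by Gronwall, because [k] is
bounded.  Applying this to the countably many values of simple functions that
approximate [V_h u] and [R_h u] gives [a(V_h u - R_h u, V_h u - R_h u) = 0]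
almost everywhere.  Hence [rho = R_h u - u], its second weak derivative is
[R_h u'' - u''], and the estimate is the Ritz estimate integrated in time.

The kernel is bounded because [t^(- alpha t) / Gamma(1 - alpha t)] is Lipschitz
continuous: [|alpha t|] and [|alpha' t|] are at most [Q t], which absorbs
[1 / t] and [ln t].
*)

Set Implicit Arguments.
Unset Strict Implicit.

(** * Integrals of nonnegative functions and Gronwall's lemma *)

(** Two features of the objects shape the proof. Nothing is linear on the nose: [wpartial] selects
    some weak derivative and the Ritz map is any solution of its equations, so linearity holds only
    up to vectors of seminorm zero, and it is in this form ([bounded_quasilinear]) that maps are
    pushed through Bochner integrals and weak derivatives. Moreover, integrands such as [N (f t)],
    or the convolution with the kernel, are never shown to be measurable; their integrals are
    compared straight from the definition as a supremum over simple functions.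

    The comparison of norms rests on [eig_class], which contains both [Hdot 2] and the finite
    element space: on it the energy form is a semi-inner product, and Bessel's inequality bounds the
    norm of [Hdot 1] by the energy norm. This is where the factor [Num.sqrt K] of the final constant
    comes from. The constants that carry weak derivatives across the Ritz error may depend on [h];
    uniformity in [h] is only required of the pointwise Ritz estimate, which is integrated
    separately. *)

Section NonnegativeIntegral.
Import HBNNSimple.

(** A simple function below [f], cut off on the null set [A] and divided by [C], is a simple
    function below [g]. Arguing on the suprema that define the two integrals keeps measurability of
    [f] and [g] out of the statement. *)
Lemma ge0_le_ae_integral_mull (d : measure_display) (T : measurableType d)
    (R : realType) (mu : {measure set T -> \bar R}) (D A : set T)
    (f g : T -> \bar R) (C : R) :
  0 < C -> measurable A -> mu A = 0%E ->
  (forall x, D x -> (0 <= f x)%E) -> (forall x, D x -> (0 <= g x)%E) ->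
  (forall x, D x -> ~ A x -> (f x <= C%:E * g x)%E) ->
  (\int[mu]_(x in D) f x <= C%:E * \int[mu]_(x in D) g x)%E.
Proof.
move=> C0 mA A0 f0 g0 fg; rewrite !ge0_integralE//.
apply: ge_ereal_sup => _ [h /= hf <-].
have mA' : measurable (~` A) by exact: measurableC.
have Ci : 0 <= C^-1 by rewrite invr_ge0 ltW.
pose k := mul_nnsfun h (indic_nnsfun R mA').
pose l := scale_nnsfun k Ci.
have -> : sintegral mu h = sintegral mu k.
  rewrite -!integralT_nnsfun; apply: ge0_ae_eq_integral => //.
  - exact/measurable_EFinP.
  - exact/measurable_EFinP.
  - by move=> x _; rewrite lee_fin.
  - by move=> x _; rewrite lee_fin.
  - exists A; split => // x /= H; apply: contrapT => nAx; apply: H => _ /=.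
    by rewrite mindicE mem_set// mulr1.
have -> : sintegral mu k = (C%:E * sintegral mu l)%E.
  rewrite -sintegralrM; apply: eq_sintegral => x /=.
  by rewrite mulrA divff ?mul1r ?gt_eqF.
rewrite lee_pmul2l// ?lte_fin//; apply: ereal_sup_ubound; exists l => //= x.
rewrite mindicE /patch; case: ifPn => [|xD].
  rewrite inE => Dx; case: (pselect (A x)) => Ax.
    by rewrite memNset ?mulr0 ?g0//; apply.
  rewrite mem_set// mulr1 -(@lee_pmul2l _ C%:E)// ?lte_fin//.
  rewrite -EFinM mulrA divff ?gt_eqF// mul1r.
  by apply: le_trans (fg _ Dx Ax); have := hf x; rewrite /patch mem_set.
have := hf x; rewrite /patch (negbTE xD) lee_fin => hx.
have -> : h x = 0 by apply/eqP; rewrite eq_le hx/=.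
by rewrite mul0r mulr0.
Qed.

Lemma ge0_le_integral_mull (d : measure_display) (T : measurableType d)
    (R : realType) (mu : {measure set T -> \bar R}) (D : set T)
    (f g : T -> \bar R) (C : R) :
  0 < C -> (forall x, D x -> (0 <= f x)%E) -> (forall x, D x -> (0 <= g x)%E) ->
  (forall x, D x -> (f x <= C%:E * g x)%E) ->
  (\int[mu]_(x in D) f x <= C%:E * \int[mu]_(x in D) g x)%E.
Proof.
move=> C0 f0 g0 fg; apply: (@ge0_le_ae_integral_mull _ _ _ _ _ set0) => //.
by move=> x Dx _; exact: fg.
Qed.

(** The positive and negative parts of [f] both have integrals between 0 and [C] times that of [g],
    so their difference has modulus at most that number. It serves for the Volterra term, whose
    integrand contains the kernel and is not known to be measurable. *)
Lemma normr_Rintegral_le (d : measure_display) (T : measurableType d)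
    (R : realType) (mu : {measure set T -> \bar R}) (D : set T)
    (f g : T -> R) (C : R) :
  0 < C -> (forall x, D x -> 0 <= g x) ->
  (forall x, D x -> `|f x| <= C * g x) ->
  (\int[mu]_(x in D) (g x)%:E < +oo)%E ->
  `|Rintegral mu D f| <= C * Rintegral mu D g.
Proof.
move=> C0 g0 fg goo; set I := integral mu D (EFin \o g).
have I0 : (0 <= I)%E by apply: integral_ge0 => x Dx; rewrite lee_fin g0.
have If : I \is a fin_num by rewrite ge0_fin_numE.
have P (s : T -> \bar R) : (forall x, D x -> 0 <= s x <= `|f x|%:E)%E ->
    (0 <= \int[mu]_(x in D) s x <= C%:E * I)%E.
  move=> sf; apply/andP; split.
    by apply: integral_ge0 => x /sf/andP[].
  apply: ge0_le_integral_mull => // [x /sf/andP[]//|x Dx].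
  by apply: le_trans (_ : `|f x|%:E <= _)%E;
    [case/andP: (sf _ Dx)|rewrite -EFinM lee_fin fg].
rewrite /Rintegral -/I integralE.
have /andP[p0 pI] : (0 <= \int[mu]_(x in D) (EFin \o f)^\+ x <= C%:E * I)%E.
  apply: P => x Dx; rewrite funeposE/= -EFin_max !lee_fin le_max lexx orbT/=.
  by rewrite ge_max ler_norm normr_ge0.
have /andP[n0 nI] : (0 <= \int[mu]_(x in D) (EFin \o f)^\- x <= C%:E * I)%E.
  apply: P => x Dx; rewrite funenegE/= -EFin_max !lee_fin le_max lexx orbT/=.
  by rewrite ge_max normr_ge0 andbT -normrN ler_norm.
have CI : (C%:E * I)%E = (C * fine I)%:E by rewrite EFinM fineK.
rewrite CI in pI nI.
move: p0 pI n0 nI.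
case: (\int[mu]_(x in D) (EFin \o f)^\+ x)%E => //= p.
case: (\int[mu]_(x in D) (EFin \o f)^\- x)%E => //= n.
rewrite !lee_fin => p0 pI n0 nI; rewrite /I.
by rewrite ler_norml; apply/andP; split; lra.
Qed.

End NonnegativeIntegral.

(** The interval is cut into steps of length [e = 1 / (2 M)]. If the integral of [y] over the first
    [n] steps is 0, then almost everywhere on the first [n + 1] steps [y] is at most [M] times its
    integral [j] over them, and vanishes before the last one; integrating gives
    [j <= M e j = j / 2], hence [j = 0]. *)
Lemma gronwall_ae0 (R : realType) (T M : R) (y : R -> R) :
  0 < T -> 0 < M -> measurable_fun `]0, T[ y ->
  (forall t, 0 < t < T -> 0 <= y t) ->
  (\int[lebesgue_measure]_(t in `]0%R, T[) (y t)%:E < +oo)%E ->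
  {ae lebesgue_measure, forall t : R, 0 < t < T ->
    y t <= M * Rintegral lebesgue_measure `]0, t[ y} ->
  {ae lebesgue_measure, forall t : R, 0 < t < T -> y t = 0}.
Proof.
move=> T0 M0 my y0' yoo [A [mA A0 yA]].
have y0 t : [set` `]0, T[] t -> 0 <= y t by rewrite /= in_itv/=; exact: y0'.
pose e := (2 * M)^-1.
have e0 : 0 < e by rewrite invr_gt0 mulr_gt0.
have Me : M * e = 2^-1 by rewrite /e; field; lra.
pose D n := [set` `]0, Num.min T (n%:R * e)[] : set R.
have DT n : D n `<=` `]0, T[.
  by apply: subset_itvl; rewrite bnd_simp ge_min lexx.
pose J n := (\int[lebesgue_measure]_(t in D n) (y t)%:E)%E.
have sub (B B' : set R) : measurable B -> measurable B' -> B `<=` B' ->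
    B' `<=` `]0, T[ ->
    (0 <= \int[lebesgue_measure]_(t in B) (y t)%:E <=
     \int[lebesgue_measure]_(t in B') (y t)%:E)%E.
  move=> mB mB' BB' B'T; apply/andP; split.
    by apply: integral_ge0 => t /BB'/B'T; rewrite lee_fin; exact: y0.
  apply: ge0_subset_integral => //.
    by apply/measurable_EFinP; exact: measurable_funS my.
  by move=> t /B'T; rewrite lee_fin; exact: y0.
have mD n : measurable (D n) by exact: measurable_itv.
have J0 n : J n = 0%E.
  elim: n => [|n IHn].
    rewrite /J (_ : D 0%N = set0) ?integral_set0//.
    apply/seteqP; split => // t;
      rewrite /D /= in_itv/= mul0r lt_min => /andP[+ /andP[_]].
    by move=> /lt_trans/[apply]; rewrite ltxx.
  have /andP[J0 _] := sub _ _ (mD n.+1) (mD n.+1) (@subset_refl _ _) (@DT n.+1).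
  have /andP[_ JT] := sub _ _ (mD n.+1) (measurable_itv `]0, T[) (@DT n.+1) (@subset_refl _ _).
  have Jf : J n.+1 \is a fin_num by rewrite ge0_fin_numE//;
    exact: le_lt_trans yoo.
  set j := fine (J n.+1).
  have jE : J n.+1 = j%:E by rewrite fineK.
  have j0 : 0 <= j by rewrite -lee_fin -jE.
  have [j_0|jn0] := eqVneq j 0; first by rewrite -/(J _) jE j_0.
  have {j0}j0 : 0 < j by rewrite lt_neqAle eq_sym jn0.
  suff : (J n.+1 <= (M * j)%:E * e%:E)%E.
    rewrite jE -EFinM lee_fin mulrAC Me => h; exfalso; lra.
  pose B := [set` `[n%:R * e, n.+1%:R * e]] : set R.
  have mB : measurable B by exact: measurable_itv.
  have -> : e%:E = lebesgue_measure B.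
    rewrite /B lebesgue_measure_itv/= lte_fin ltr_pM2r// ltr_nat ltnSn.
    by rewrite -EFinB -mulrBl -natrB// subSnn mul1r.
  (* Off [A], the hypothesis bounds [y] by [M * j] on the last step [B]; before it the integral over
     []0, t[] is dominated by [J n = 0], so the indicator of [B] may be inserted. *)
  apply: (@le_trans _ _ ((M * j)%:E * \int[lebesgue_measure]_(t in D n.+1) (\1_B t)%:E)%E).
    apply: (@ge0_le_ae_integral_mull _ _ _ _ _ A) => //.
    - by rewrite mulr_gt0.
    - by move=> t /DT; rewrite lee_fin; exact: y0.
    - move=> t Dt nAt; have tT := DT _ _ Dt.
      have yt : y t <= M * Rintegral lebesgue_measure `]0, t[ y.
        apply: contrapT => h; apply: nAt; apply: yA => /= /(_ tT) //.
      rewrite -EFinM lee_fin indicE; apply: (le_trans yt).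
      move: Dt; rewrite /D /= in_itv/= lt_min => /and3P[t0 tT' tn].
      have [tn1|tn1] := leP (n%:R * e) t.
        rewrite mem_set; last by rewrite /B/= in_itv/= tn1 ltW.
        rewrite mulr1 ler_pM2l// /Rintegral /j.
        have /andP[h1 h2] := sub [set` `]0, t[] (D n.+1) (measurable_itv _) (mD n.+1)
          ltac:(by apply: subset_itvl; rewrite bnd_simp le_min !ltW) (@DT n.+1).
        by rewrite fine_le// ge0_fin_numE//; apply: (le_lt_trans h2);
          rewrite -/(J _) jE ltry.
      rewrite memNset; last by rewrite /B/= in_itv/= leNgt tn1.
      have /andP[h1 h2] := sub [set` `]0, t[] (D n) (measurable_itv _) (mD n)
          ltac:(by apply: subset_itvl; rewrite bnd_simp le_min !ltW) (@DT n).
      rewrite -/(J n) IHn in h2.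
      by rewrite /Rintegral (@le_anti _ _ (integral _ _ _) 0%E) ?h1 ?h2//= !mulr0.
  rewrite lee_pmul2l ?lte_fin ?mulr_gt0// integral_indic//.
  - by apply: le_measure; rewrite ?inE; [apply: measurableI;
    [exact: mB|exact: mD]|exact: mB|exact: subIsetl].
  - exact: mD.
have [n nT] : exists n : nat, T <= n%:R * e.
  exists (Num.bound (T / e)); rewrite -ler_pdivrMr//.
  by apply/ltW/archi_boundP/divr_ge0; exact: ltW.
have := J0 n; rewrite /J /D (min_idPl nT) => yT.
have my' : measurable_fun `]0, T[ (EFin \o y) by exact/measurable_EFinP.
have := @ae_eq_integral_abs _ _ R lebesgue_measure _ (measurable_itv `]0, T[) _ my'.
have yT' : (\int[lebesgue_measure]_(t in `]0%R, T[) `|(EFin \o y) t|)%E = 0%E.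
  rewrite -yT; apply: eq_integral => t.
  by rewrite inE => /y0 yt /=; rewrite ger0_norm.
move=> [/(_ yT') + _]; apply: filterS => t /= h t0; have := h _.
by rewrite in_itv/= => /(_ t0) [].
Qed.

(** * Boundedness of the kernel *)

(** The half-line is exhausted by the compact intervals [F n], on which the fundamental theorem of
    calculus gives a difference of two values of [G], at most [B]. Only the bounds on [G] enter, not
    its limits at 0 and infinity. *)
Lemma ge0_integral_primitive_le (R : realType) (G g : R -> R) (B : R) :
  (forall s : R, 0 < s -> is_derive s 1 G (g s)) ->
  (forall s : R, 0 < s -> {for s, continuous g}) ->
  (forall s : R, 0 < s -> 0 <= g s) -> (forall s : R, 0 < s -> 0 <= G s <= B) ->
  (\int[lebesgue_measure]_(s in `]0%R, +oo[) (g s)%:E <= B%:E)%E.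
Proof.
move=> dG cg g0 GB.
pose F (n : nat) := [set` `[n.+1%:R^-1, n.+1%:R + 1]] : set R.
have F0 n s : F n s -> 0 < s.
  rewrite /F /= in_itv/= => /andP[+ _]; apply: lt_le_trans.
  by rewrite invr_gt0.
have -> : [set` `]0, +oo[] = \bigcup_n F n :> set R.
  apply/seteqP; split => s /=; last by move=> [n _ /F0 s0]; rewrite in_itv/= s0.
  rewrite in_itv/= andbT => s0.
  exists (maxn (Num.bound s) (Num.bound s^-1)) => //.
  rewrite /F /= in_itv/=; apply/andP; split.
    rewrite -[leRHS]invrK lef_pV2 ?posrE ?invr_gt0//.
    apply: le_trans (_ : (Num.bound s^-1)%:R <= _).
      by apply/ltW/archi_boundP; rewrite invr_ge0 ltW.
    by rewrite ler_nat ltnW// ltnS leq_maxr.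
  apply: le_trans (_ : (Num.bound s)%:R <= _).
    by apply/ltW/archi_boundP; rewrite ltW.
  rewrite natr1 ler_nat; apply: leq_trans (leq_maxl _ _) _.
  exact: leqW (leqnSn _).
have mF n : measurable (F n) by exact: measurable_itv.
have cF n : {within F n, continuous g}.
  apply: continuous_in_subspaceT => s; rewrite inE => /F0; exact: cg.
have : (\int[lebesgue_measure]_(x in F i) (g x)%:E)%E @[i --> \oo] -->
    (\int[lebesgue_measure]_(x in \bigcup_i F i) (g x)%:E)%E.
  apply: ge0_nondecreasing_set_cvg_integral => //.
  - move=> n m nm; apply/subsetPset => s; rewrite /F /= !in_itv/= => /andP[a b].
    apply/andP; split.
      by apply: le_trans a; rewrite lef_pV2 ?posrE// ler_nat ltnS.
    by apply: (le_trans b); rewrite lerD2r ler_nat ltnS.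
  - move=> n; apply/measurable_EFinP;
    apply: subspace_continuous_measurable_fun => //.
  - by move=> n s /F0 s0; rewrite lee_fin g0.
move/cvge_to_le; apply; near=> n.
have n1 : n.+1%:R^-1 < n.+1%:R + 1 :> R.
  apply: (@le_lt_trans _ _ 1); first by rewrite invf_le1// ler1n.
  by rewrite natr1 ltr1n.
have Fs s : s \in `]n.+1%:R^-1, n.+1%:R + 1[ -> 0 < s.
  by rewrite in_itv/= => /andP[+ _]; apply: lt_trans; rewrite invr_gt0.
have cG s : 0 < s -> {for s, continuous G}.
  by move=> /dG [d _]; apply: differentiable_continuous; exact/derivable1_diffP.
have n0 : 0 < n.+1%:R^-1 :> R by rewrite invr_gt0.
rewrite (continuous_FTC2 n1 (cF n) (F := G)).
- have /andP[a _] := GB _ n0.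
  have /andP[_ b] := GB (n.+1%:R + 1) (lt_trans n0 n1).
  by rewrite -EFinB lee_fin; lra.
- split.
  + by move=> s /Fs /dG[].
  + by apply: cvg_at_right_filter; exact: cG.
  + by apply: cvg_at_left_filter; apply: cG; exact: lt_trans n1.
- by move=> s /Fs/dG[_]; rewrite derive1E.
Unshelve. all: by end_near. Qed.

(** For [q <= p], the inequality [1 + x <= expR x] at [x = q - p] bounds the difference by
    [(p - q) * expR p]. The symmetric right-hand side covers both orders. *)
Lemma expR_lip (R : realType) (p q : R) :
  `|expR p - expR q| <= `|p - q| * (expR p + expR q).
Proof.
wlog pq : p q / q <= p.
  move=> H; have [/H//|/ltW/H] := leP q p.
  by rewrite (distrC p q) (distrC (expR p)) (addrC (expR p)).
rewrite !ger0_norm ?subr_ge0 ?ler_expR// mulrDr.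
apply: (@le_trans _ _ ((p - q) * expR p)); last first.
  by rewrite lerDl mulr_ge0 ?subr_ge0// expR_ge0.
have -> : expR q = expR p * expR (q - p) by rewrite -expRD addrC subrK.
rewrite -{1}[expR p]mulr1 -mulrBr mulrC ler_wpM2r ?expR_ge0//.
by have := expR_ge1Dx (q - p); lra.
Qed.

Lemma is_derive1_continuous (R : realType) (f : R -> R) (x d : R) :
  is_derive x 1 f d -> {for x, continuous f}.
Proof.
by case=> df _; apply: differentiable_continuous; exact/derivable1_diffP.
Qed.

(** * Gamma on [[1 - a, 1]]: Lipschitz continuity and a positive lower bound *)

Section Gamma_bounds.
Variables (R : realType) (a : R).
Hypotheses (a0 : 0 <= a) (a1 : a < 1).

(** Half of the room left by the singularity [s^(- a)]: a logarithm costs a factor [s^(- c)] near 0,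
    and [- a - c = c - 1] is still greater than [-1]. *)
Let c := (1 - a) / 2.
Let c0 : 0 < c. Proof. by move: (a1) => ?; rewrite /c; lra. Qed.
Let c1 : c < 1. Proof. by move: (a0) => ?; rewrite /c; lra. Qed.

(* [g] is the derivative of the bounded function [G], of order [s^(c - 1)] at 0
   and [s^(- c - 1)] at infinity; this dominates every integrand below. *)
Let G (s : R) := 1 - (1 + s `^ c)^-1.
Let g (s : R) := c * s `^ (c - 1) / (1 + s `^ c) ^+ 2.

Let g0 (s : R) : 0 < s -> 0 < g s.
Proof.
move=> s0; rewrite /g; apply: divr_gt0; first by rewrite mulr_gt0 ?powR_gt0.
by rewrite exprn_gt0// addr_gt0// powR_gt0.
Qed.

Let int_g : (\int[lebesgue_measure]_(s in `]0%R, +oo[) (g s)%:E <= 1)%E.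
Proof.
apply: (@ge0_integral_primitive_le _ G).
- move=> s s0; have d1 := is_derive1_powR c s0.
  have p0 : 1 + s `^ c != 0 by rewrite gt_eqF// addr_gt0// powR_gt0.
  have d2 := @is_deriveV _ (fun s => 1 + s `^ c) s _ 1 p0 _.
  apply: is_derive_eq.
  by rewrite /g /GRing.scale/=; field.
- move=> s s0.
  have p0 : 1 + s `^ c != 0 by rewrite gt_eqF// addr_gt0// powR_gt0.
  have cp p := is_derive1_continuous (is_derive1_powR p s0).
  rewrite /g; apply: cvgM; first by apply: cvgM; [exact: cvg_cst|exact: cp].
  apply: cvgV; first by rewrite expf_neq0.
  by apply: cvgM; apply: cvgD;
    [exact: cvg_cst|exact: cp|exact: cvg_cst|exact: cp].
- by move=> s /g0/ltW.
- move=> s s0; rewrite /G.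
  have p0 := powR_gt0 c s0.
  have : (1 + s `^ c)^-1 <= 1 by rewrite invf_le1; lra.
  have : 0 <= (1 + s `^ c)^-1 by rewrite invr_ge0; lra.
  by move=> *; apply/andP; split; lra.
Qed.

Let powRexp (s p : R) : 0 < s -> s `^ p = expR (p * ln s).
Proof. by move=> s0; rewrite /powR gt_eqF. Qed.

(** The factor [1 + |ln s|] lets one bound control both the integrand of Gamma and its derivative in
    [x]. For [s <= 1] the logarithmic factor is at most [s^(- c) / c] and [(1 + s^c)^2 <= 4]. For
    [s > 1] it is at most [s], the cubic term of the exponential gives [s * expR (- s) <= 6 / s^2],
    and [(1 + s^c)^2 <= 4 s^(2 c)]; hence [24 = 6 * 4]. *)
Lemma Gamma_integrand_bound (s x : R) : 0 < s -> 1 - a <= x <= 1 ->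
  s `^ (x - 1) * (1 + `|ln s|) * expR (- s) <= 24 / c ^+ 2 * g s.
Proof.
move: (a0) (a1) (c0) (c1) => a0' a1' c0' c1' s0 /andP[xa x1].
have sc0 := powR_gt0 c s0.
have C0 : 0 <= 24 / c ^+ 2 by rewrite divr_ge0// exprn_ge0// ltW.
have cc : 1 <= c^-1 by rewrite invf_ge1// ltW.
have [s1|s1] := leP s 1.
  have L0 : ln s <= 0 by exact: ln_le0.
  have h1 : s `^ (x - 1) <= s `^ (- a).
    by rewrite !powRexp// ler_expR ler_wnM2r//; lra.
  have h2 : 1 + `|ln s| <= s `^ (- c) / c.
    rewrite ler_pdivlMr// powRexp// ler0_norm//.
    have := expR_ge1Dx (- c * ln s); nra.
  have h3 : expR (- s) <= 1 by rewrite expR_le1; lra.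
  have h4 : s `^ c <= 1 by rewrite powRexp// expR_le1; nra.
  have h5 : s `^ (- a) * s `^ (- c) = s `^ (c - 1).
    by rewrite !powRexp// -expRD; congr expR; rewrite /c; field.
  apply: (@le_trans _ _ (s `^ (- a) * (s `^ (- c) / c) * 1)).
    rewrite ler_pM ?expR_ge0// ?mulr_ge0 ?powR_ge0 ?addr_ge0//.
    by rewrite ler_pM ?powR_ge0 ?addr_ge0.
  rewrite mulr1 mulrA h5 /g.
  have h6 : (1 + s `^ c) ^+ 2 <= 4 by nra.
  have h7 : 4^-1 <= ((1 + s `^ c) ^+ 2)^-1.
    by rewrite lef_pV2 ?posrE// exprn_gt0// addr_gt0.
  have p0 := powR_gt0 (c - 1) s0.
  rewrite (_ : 24 / c ^+ 2 * _ = s `^ (c - 1) / c * (24 * ((1 + s `^ c) ^+ 2)^-1)); last first.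
    by field; rewrite !gt_eqF// addr_gt0.
  rewrite ler_peMr//; last lra.
  by rewrite divr_ge0// ltW.
have L0 : 0 <= ln s by exact: ln_ge0 (ltW s1).
have h1 : s `^ (x - 1) <= 1.
  by rewrite powRexp// expR_le1 mulr_le0_ge0//; lra.
have h2 : 1 + `|ln s| <= s.
  by rewrite ger0_norm//; have := expR_ge1Dx (ln s); rewrite lnK.
have h3 : s ^+ 3 <= 6 * expR s.
  have := @expR_ge1Dxn _ s 2 (ltW s0); rewrite (_ : 3`!%:R = 6 :> R)//.
  lra.
have h4 : 1 <= s `^ c by rewrite powRexp// -[leLHS]expR0 ler_expR mulr_ge0// ltW.
have h5 : s `^ c * s `^ c * (s ^+ 2)^-1 <= s `^ (c - 1).
  have -> : (s ^+ 2)^-1 = expR (- 2 * ln s).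
    by rewrite mulNr expRN expRM_natl lnK.
  by rewrite !powRexp// -!expRD ler_expR; nra.
apply: (@le_trans _ _ (1 * s * expR (- s))).
  rewrite ler_pM ?expR_ge0// ?mulr_ge0 ?powR_ge0 ?addr_ge0//.
  by rewrite ler_pM ?powR_ge0 ?addr_ge0.
apply: (@le_trans _ _ (6 / s ^+ 2)).
  by rewrite mul1r expRN ler_pdivrMr ?expR_gt0// mulrAC ler_pdivlMr ?exprn_gt0//.
rewrite /g.
have h6 : (1 + s `^ c) ^+ 2 <= 4 * (s `^ c * s `^ c) by nra.
rewrite (_ : 24 / c ^+ 2 * _ = 24 / c * s `^ (c - 1) / (1 + s `^ c) ^+ 2);
  last first.
  by field; rewrite !gt_eqF// addr_gt0.
rewrite ler_pdivlMr ?exprn_gt0 ?addr_gt0//.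
apply: (@le_trans _ _ (6 / s ^+ 2 * (4 * (s `^ c * s `^ c)))).
  by rewrite ler_wpM2l// divr_ge0// exprn_ge0// ltW.
apply: (@le_trans _ _ (24 * s `^ (c - 1))); first by lra.
by rewrite ler_wpM2r ?powR_ge0// ler_peMr.
Qed.

Let f (x s : R) := s `^ (x - 1) * expR (- s).

Let f_int x : 1 - a <= x <= 1 ->
  lebesgue_measure.-integrable [set` `]0, +oo[] (EFin \o f x).
Proof.
move=> xa; apply/integrableP; split.
  apply/measurable_EFinP/measurable_funM.
    by apply: measurable_funTS; exact: measurable_powR.
  by apply: measurable_funTS; apply: measurableT_comp => //;
    exact: measurable_expR.
apply: (@le_lt_trans _ _ ((24 / c ^+ 2)%:E *
    \int[lebesgue_measure]_(s in `]0%R, +oo[) (g s)%:E)%E).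
  apply: ge0_le_integral_mull => //.
  - by rewrite divr_gt0// exprn_gt0.
  - by move=> s; rewrite /= in_itv/= andbT lee_fin => /g0/ltW.
  - move=> s; rewrite /= in_itv/= andbT => s0; rewrite -EFinM lee_fin.
    apply: le_trans (Gamma_integrand_bound s0 xa).
    rewrite /f ger0_norm ?mulr_ge0 ?powR_ge0 ?expR_ge0//.
    by rewrite ler_wpM2r ?expR_ge0// ler_peMr ?powR_ge0// lerDl.
apply: (@le_lt_trans _ _ (24 / c ^+ 2)%:E); last exact: ltry.
rewrite -[leRHS]mule1; apply: lee_wpmul2l => //.
by rewrite lee_fin divr_ge0// exprn_ge0// ltW.
Qed.

(** [expR_lip], applied to [s^(x - 1) = expR ((x - 1) * ln s)], replaces differentiation under the
    integral sign. It leaves two terms, each dominated by [24 / c^2 * g], and the integral of [g] is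
    at most 1. *)
Lemma Gamma_lipschitz : exists2 L : R, 0 < L & forall x y,
  1 - a <= x <= 1 -> 1 - a <= y <= 1 -> `|Gamma x - Gamma y| <= L * `|x - y|.
Proof.
exists (2 * (24 / c ^+ 2)); first by rewrite mulr_gt0// divr_gt0// exprn_gt0.
move=> x y hx hy; have [->|xy] := eqVneq x y;
  first by rewrite !subrr normr0 mulr0.
rewrite /Gamma -RintegralB//; [|exact: f_int|exact: f_int].
have xy0 : 0 < `|x - y| by rewrite normr_gt0 subr_eq0.
have g0' (s : R) : [set` `]0, +oo[] s -> 0 <= g s.
  by rewrite /= in_itv/= andbT => /g0/ltW.
apply: (@le_trans _ _ (2 * (24 / c ^+ 2) * `|x - y| *
    Rintegral lebesgue_measure `]0, +oo[ g)).
  apply: normr_Rintegral_le => //.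
  - by rewrite !mulr_gt0// ?invr_gt0 ?exprn_gt0.
  - move=> s; rewrite /= in_itv/= andbT => s0.
    rewrite -mulrBl normrM (ger0_norm (expR_ge0 _)).
    have hx1 := Gamma_integrand_bound s0 hx.
    have hy1 := Gamma_integrand_bound s0 hy.
    apply: (@le_trans _ _ (`|x - y| * (s `^ (x - 1) * (1 + `|ln s|) * expR (- s)
        + s `^ (y - 1) * (1 + `|ln s|) * expR (- s)))); last first.
      rewrite [leRHS]mulrAC [leRHS]mulrC; apply: ler_wpM2l; first exact: ltW.
      lra.
    rewrite -2!mulrDl !mulrA ler_wpM2r ?expR_ge0//.
    rewrite !powRexp//; apply: (le_trans (expR_lip _ _)).
    rewrite -mulrBl (_ : x - 1 - (y - 1) = x - y); last ring.
    rewrite normrM -!mulrA ler_wpM2l// mulrC ler_wpM2l ?addr_ge0 ?expR_ge0//.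
    by rewrite lerDr.
  - exact: le_lt_trans int_g (ltry _).
rewrite ler_piMr ?mulr_ge0// ?invr_ge0 ?exprn_ge0// ?(ltW c0)//.
rewrite -lee_fin; apply: le_trans int_g; rewrite /Rintegral fineK//.
rewrite ge0_fin_numE; first exact: le_lt_trans int_g (ltry _).
by apply: integral_ge0 => s /g0'; rewrite lee_fin.
Qed.

(** The interval []0, 1[] alone contributes this much: there [s^(x - 1) >= 1] because [x <= 1], and
    [expR (- s) >= expR (- 1)]. *)
Lemma Gamma_ge (x : R) : 1 - a <= x <= 1 -> expR (- 1) <= Gamma x.
Proof.
move=> xa; rewrite /Gamma /Rintegral; have fx := f_int xa.
have f0 (s : R) : 0 <= f x s by rewrite mulr_ge0 ?powR_ge0 ?expR_ge0.
rewrite -lee_fin fineK; last exact: integrable_fin_num.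
have sub : ([set` `]0, 1[] : set R) `<=` [set` `]0, +oo[].
  by apply: subset_itvl; rewrite bnd_simp.
apply: (@le_trans _ _ (\int[lebesgue_measure]_(s in `]0%R, 1%R[) (f x s)%:E)%E).
  have -> : (expR (- 1))%:E =
      (\int[lebesgue_measure]_(s in `]0%R, 1%R[) cst (expR (- 1))%:E s)%E :> \bar R.
    rewrite integral_cst//= lebesgue_measure_itv/= lte_fin ltr01.
    by rewrite oppr0 adde0 mule1.
  rewrite -[leRHS]mul1e; apply: ge0_le_integral_mull => //.
  - by move=> s _; rewrite lee_fin expR_ge0.
  - by move=> s _; rewrite lee_fin f0.
  move=> s; rewrite /= in_itv/= => /andP[s0 s1]; rewrite mul1e lee_fin.
  case/andP: xa => _ x1.
  rewrite -[leLHS]mul1r /f ler_pM ?expR_ge0//; last by rewrite ler_expR; lra.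
  rewrite powRexp// -[leLHS]expR0 ler_expR mulr_le0//; first lra.
  by apply: ln_le0; exact: ltW.
apply: ge0_subset_integral => //; first by case/integrableP: fx.
by move=> s _; rewrite lee_fin f0.
Qed.

End Gamma_bounds.

(** * Derivatives relative to [[0, T]] *)

Section Interval.
Variables (R : realType) (T : R).
Local Notation D := ([set` `[0, T]] : set R).

Lemma is_derive_deriv_in (f : R -> R) (t : R) : 0 < t < T ->
  derivable_in D f t -> is_derive t 1 f (deriv_in D f t).
Proof.
move=> tT; rewrite /derivable_in /deriv_in; set l := lim _ => fl.
have tD : \forall s \near t, 0 < s < T.
  have : t \in `]0, T[ by rewrite in_itv.
  by move=> /near_in_itvoo; apply: filterS => s; rewrite in_itv.
suff H : h^-1 *: (f (h *: 1 + t) - f t) @[h --> 0^'] --> l.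
  split; first by apply/cvg_ex; exists l.
  exact: cvg_lim H.
apply/cvgrPdist_le => e e0.
have /cvgrPdist_le/(_ _ e0) : diff_quotient f t @ within D t^' --> l by [].
rewrite !near_withinE => H.
have : \forall s \near t, s != t -> `|l - diff_quotient f t s| <= e.
  near=> s => st; have sD : 0 < s < T by near: s.
  have : s != t -> D s -> `|l - diff_quotient f t s| <= e by near: s.
  by apply => //; rewrite /= in_itv/=; case/andP: sD => /ltW-> /ltW->.
rewrite !near_nbhs => /nbhs_ballP[r /= r0 Hr].
apply/nbhs_ballP; exists r => //= h; rewrite /ball/= sub0r normrN => hr h0.
have := Hr (h + t).
rewrite /ball/= opprD addrCA subrr addr0 normrN => /(_ hr).
rewrite -subr_eq0 addrK => /(_ h0); rewrite /diff_quotient addrK.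
by rewrite mulrC /GRing.scale/= mulr1.
Unshelve. all: by end_near. Qed.

Lemma derivable_in_cvg0 (f : R -> R) : 0 < T ->
  derivable_in D f 0 -> f s @[s --> 0^'+] --> f 0.
Proof.
move=> T0; rewrite /derivable_in; set l := lim _ => fl.
have H : diff_quotient f 0 @ 0^'+ --> l.
  apply: cvg_trans fl => A; rewrite !near_simpl !near_withinE => H.
  near=> s => s0; have sT : s < T by near: s; exact: lt_nbhsl.
  have : s != 0 -> D s -> A (diff_quotient f 0 s) by near: s.
  by apply; rewrite ?gt_eqF//= in_itv/= !ltW.
have H2 : (diff_quotient f 0 s * s + f 0) @[s --> 0^'+] --> l * 0 + f 0.
  apply: cvgD; last exact: cvg_cst.
  by apply: cvgM => //; apply: cvg_at_right_filter; exact: cvg_id.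
rewrite mulr0 add0r in H2; apply: cvg_trans H2.
apply: near_eq_cvg; near=> s.
have s0 : s != 0 by near: s; exact: nbhs_right_neq.
by rewrite /diff_quotient subr0 divfK// subrK.
Unshelve. all: by end_near. Qed.

(** The left endpoint is included because [alpha] and its derivative will be compared with their
    values at 0; continuity there comes from the one-sided derivative. *)
Lemma derivable_in_MVT (f : R -> R) (M : R) :
  (forall t, D t -> derivable_in D f t) ->
  (forall t, 0 < t < T -> `|deriv_in D f t| <= M) ->
  forall s t, 0 <= s < T -> 0 <= t < T -> `|f s - f t| <= M * `|s - t|.
Proof.
move=> df fM s t; wlog st : s t / t <= s.
  move=> H hs ht; have [/H|/ltW/H] := leP t s; first exact.
  by rewrite distrC (distrC t); exact.
move=> /andP[_ sT] /andP[t0 _].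
have [->|ts] := eqVneq s t; first by rewrite !subrr normr0 mulr0.
have {ts}ts : t < s by rewrite lt_neqAle eq_sym ts.
have d x : 0 < x < T -> is_derive x 1 f (deriv_in D f x).
  move=> xT; apply: is_derive_deriv_in => //; apply: df.
  by rewrite /= in_itv/=; case/andP: xT => /ltW-> /ltW->.
have T0 : 0 < T by lra.
have cf x : 0 < x < T -> {for x, continuous f}.
  by move=> /d; exact: is_derive1_continuous.
have cont : {within `[t, s], continuous f}.
  apply/continuous_within_itvP => //; split.
  - by move=> x; rewrite in_itv/= => /andP[tx xs]; apply: cf; lra.
  - have [t_0|tn0] := eqVneq t 0.
      rewrite t_0; apply: derivable_in_cvg0 => //; apply: df.
      by rewrite /= in_itv/= lexx ltW.
    apply: cvg_at_right_filter; apply: cf.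
    by rewrite lt_neqAle eq_sym tn0 t0/= (lt_trans ts).
  - by apply: cvg_at_left_filter; apply: cf; lra.
have [|x xst ->] := @MVT _ f (deriv_in D f) _ _ ts _ cont.
  by move=> x; rewrite in_itv/= => /andP[tx xs]; apply: d; lra.
move: xst; rewrite in_itv/= => /andP[tx xs].
by rewrite normrM ler_wpM2r//; apply: fM; lra.
Qed.

End Interval.

(** From [ln x <= x], used at [1 / s] when [s <= 1] (bound 1) and at [s] otherwise (bound
    [T ^ 2]). *)
Lemma mul_normr_ln_le (R : realType) (T s : R) :
  0 < s < T -> s * `|ln s| <= 1 + T ^+ 2.
Proof.
move=> /andP[s0 sT]; have T20 : 0 <= T ^+ 2 by exact: sqr_ge0.
have [s1|s1] := leP s 1.
  rewrite ler0_norm ?ln_le0//.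
  have := ln_sublinear (_ : 0 < s^-1); rewrite invr_gt0 => /(_ s0).
  rewrite lnV ?posrE// => h.
  apply: (@le_trans _ _ (s * s^-1)); first by rewrite ler_wpM2l// ltW.
  by rewrite divff ?gt_eqF//; lra.
rewrite ger0_norm ?ln_ge0 ?(ltW s1)//.
have h := ln_sublinear s0.
apply: (@le_trans _ _ (s * s)); first by rewrite ler_wpM2l// ltW.
nra.
Qed.

Lemma is_derive_lipschitz (R : realType) (T M : R) (f df : R -> R) :
  (forall t : R, 0 < t < T -> is_derive t 1 f (df t)) ->
  (forall t, 0 < t < T -> `|df t| <= M) ->
  forall s t, 0 < s < T -> 0 < t < T -> `|f s - f t| <= M * `|s - t|.
Proof.
move=> d dM s t; wlog st : s t / t <= s.
  move=> H hs ht; have [/H|/ltW/H] := leP t s; first exact.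
  by rewrite distrC (distrC t); exact.
move=> /andP[s0 sT] /andP[t0 tT].
have [||x xst ->] := @MVT_segment _ f df _ _ st.
- by move=> x; rewrite in_itv/= => /andP[tx xs]; apply: d; lra.
- apply: derivable_within_continuous => x; rewrite in_itv/= => /andP[tx xs].
  have xT : 0 < x < T by lra.
  by case: (d x xT).
- move: xst; rewrite in_itv/= => /andP[tx xs].
  by rewrite normrM ler_wpM2r//; apply: dM; lra.
Qed.

(** The kernel is a limit of difference quotients of [F], so a Lipschitz constant of [F] bounds it;
    differentiability of Gamma is never established. *)
Lemma vo_kernel_bounded (R : realType) (T : R) (alpha : R -> R)
    (astar Qstar : R) : 0 < T -> variable_order T alpha astar Qstar ->
  exists2 M, 0 < M & forall t, 0 < t < T -> `|vo_kernel T alpha t| <= M.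
Proof.
move=> T0; rewrite /variable_order.
set D := [set` `[0, T]]; set alpha1 := deriv_in D alpha.
move=> [as1 alphaB dalpha alphaQ [alpha00 alpha10]].
have DT t : 0 < t < T -> D t.
  by move=> /andP[t0 tT]; rewrite /D/= in_itv/= !ltW.
have D0 : D 0 by rewrite /D/= in_itv/= lexx ltW.
have as0 : 0 <= astar by have := alphaB _ D0; lra.
pose Q := Num.max Qstar 1.
have Q0 : 0 < Q by rewrite lt_max ltr01 orbT.
have QQ : Qstar <= Q by rewrite le_max lexx.
have lip1 : forall s t, 0 <= s < T -> 0 <= t < T ->
    `|alpha1 s - alpha1 t| <= Q * `|s - t|.
  apply: derivable_in_MVT => t tD; first by have [] := dalpha _ tD.
  by have [_] := alphaQ _ (DT _ tD); move=> /le_trans; exact.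
have lip0 : forall s t, 0 <= s < T -> 0 <= t < T ->
    `|alpha s - alpha t| <= Q * `|s - t|.
  apply: derivable_in_MVT => t tD; first by have [] := dalpha _ tD.
  by have [+ _] := alphaQ _ (DT _ tD); move=> /le_trans; exact.
have a0 t : 0 < t < T -> `|alpha t| <= Q * t.
  move=> /andP[t0 tT]; have := lip0 t 0; rewrite alpha00 !subr0 lexx (ltW t0).
  by rewrite (gtr0_norm t0); exact.
have a1 t : 0 < t < T -> `|alpha1 t| <= Q * t.
  move=> /andP[t0 tT]; have := lip1 t 0; rewrite alpha10 !subr0 lexx (ltW t0).
  by rewrite (gtr0_norm t0); exact.
pose c := 1 + T ^+ 2.
have c0 : 0 < c by rewrite ltr_pwDl// sqr_ge0.
pose A t := expR (- alpha t * ln t).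
have A0 t : 0 < A t by exact: expR_gt0.
pose MA := expR (Q * c).
have MA0 : 0 < MA by exact: expR_gt0.
have AM t : 0 < t < T -> A t <= MA.
  move=> tT; rewrite ler_expR; apply: le_trans (ler_norm _) _.
  have /andP[t0 _] := tT; rewrite normrM normrN.
  apply: (@le_trans _ _ (Q * t * `|ln t|)); first by rewrite ler_wpM2r// a0.
  by rewrite -mulrA ler_wpM2l ?(ltW Q0)// mul_normr_ln_le.
(* The logarithmic derivative of [A] is [- alpha t / t - alpha1 t * ln t]; its terms are bounded by
   [Q] and by [Q * c]. *)
have Alip : forall s t, 0 < s < T -> 0 < t < T ->
    `|A s - A t| <= MA * (Q * c + Q) * `|s - t|.
  apply: (@is_derive_lipschitz _ _ _ _
      (fun t => A t * (- alpha t * t^-1 + ln t * - alpha1 t))) => t tT.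
    have /andP[t0 _] := tT.
    have da : is_derive t 1 alpha (alpha1 t).
      by apply: (@is_derive_deriv_in _ T alpha t tT);
        have [] := dalpha _ (DT _ tT).
    have dl := is_derive1_ln t0.
    have de := is_derive_expR (- alpha t * ln t).
    have dm : is_derive t 1 (fun t => - alpha t * ln t)
        (- alpha t * t^-1 + ln t * - alpha1 t).
      have da' := is_deriveN da.
      exact: is_deriveM.
    exact: (@is_derive1_comp _ expR (fun t => - alpha t * ln t) t _ _ de dm).
  have /andP[t0 _] := tT.
  rewrite normrM (gtr0_norm (A0 t)) ler_pM ?(ltW (A0 t))// ?AM//.
  apply: le_trans (ler_normD _ _) _; rewrite addrC lerD//.
    rewrite normrM normrN mulrC.
    apply: (@le_trans _ _ (Q * t * `|ln t|)); first by rewrite ler_wpM2r// a1.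
    by rewrite -mulrA ler_wpM2l ?(ltW Q0)// mul_normr_ln_le.
  rewrite normrM normrN normfV (gtr0_norm t0) ler_pdivrMr//.
  exact: a0.
have [L L0 GL] := Gamma_lipschitz as0 as1.
have Gge := Gamma_ge as0 as1.
have xa t : 0 < t < T -> 1 - astar <= 1 - alpha t <= 1.
  by move=> /DT/alphaB; lra.
pose G t := Gamma (1 - alpha t).
pose e := expR (- 1) : R.
have e0 : 0 < e by exact: expR_gt0.
have Ge t : 0 < t < T -> e <= G t by move=> /xa; exact: Gge.
pose F t := t `^ (- alpha t) / G t.
(* The quotient rule in Lipschitz form: the first term comes from the increment of [A], with the
   lower bound [e] of [G] in the denominator, the second from the increment of [1 / G], where
   [L * Q] is a Lipschitz constant of [G]. *)
pose M := MA * (Q * c + Q) / e + MA * (L * Q / e ^+ 2) + 1.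
have M0 : 0 < M.
  have h1 : 0 < MA * (Q * c + Q) / e by rewrite divr_gt0// mulr_gt0// addr_gt0// mulr_gt0.
  have h2 : 0 < MA * (L * Q / e ^+ 2) by rewrite mulr_gt0// divr_gt0// ?mulr_gt0// exprn_gt0.
  by rewrite /M; lra.
have FM s t : 0 < s < T -> 0 < t < T -> `|F s - F t| <= M * `|s - t|.
  move=> hs ht; have /andP[s0 sT] := hs; have /andP[t0 tT] := ht.
  have FE x : 0 < x -> F x = A x / G x by move=> x0; rewrite /F /A /powR gt_eqF.
  rewrite !FE//.
  have Gs := lt_le_trans e0 (Ge _ hs); have Gt := lt_le_trans e0 (Ge _ ht).
  have -> : A s / G s - A t / G t =
      (A s - A t) / G s + A t * ((G t - G s) / (G s * G t)).
    by field; rewrite !gt_eqF.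
  have ie x : 0 < x < T -> 0 < G x -> (G x)^-1 <= e^-1.
    by move=> hx Gx; rewrite lef_pV2 ?posrE// Ge.
  apply: le_trans (ler_normD _ _) _;
    rewrite /M [leRHS]mulrDl [X in _ <= X + _]mulrDl mul1r.
  apply: (@le_trans _ _ (MA * (Q * c + Q) / e * `|s - t| +
      MA * (L * Q / e ^+ 2) * `|s - t|)); last by rewrite lerDl.
  apply: lerD.
    rewrite normrM normfV (gtr0_norm Gs) [leRHS]mulrAC.
    by rewrite ler_pM ?invr_ge0 ?(ltW Gs)// ?Alip// ie.
  rewrite normrM (gtr0_norm (A0 t)) -mulrA ler_pM ?(ltW (A0 t))// ?AM//.
  rewrite normrM normfV normrM (gtr0_norm Gs) (gtr0_norm Gt) [leRHS]mulrAC.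
  rewrite ler_pM ?invr_ge0 ?mulr_ge0 ?(ltW Gs) ?(ltW Gt)//.
    rewrite /G; apply: (le_trans (GL _ _ (xa _ ht) (xa _ hs))).
    rewrite -mulrA ler_wpM2l ?(ltW L0)// distrC.
    rewrite (_ : 1 - alpha s - _ = alpha t - alpha s); last by ring.
    by rewrite (distrC s) lip0// ?(ltW t0) ?(ltW s0).
  by rewrite invfM expr2 invfM ler_pM ?invr_ge0 ?(ltW Gs) ?(ltW Gt) ?ie.
exists M => // t tT; have /andP[t0 _] := tT.
rewrite /vo_kernel gt_eqF// /vo_kernel_pos /deriv_in -/(F).
set D' := [set` `]0, T]].
have [cF|ncF] := pselect (cvg (diff_quotient F t @ within D' t^')); last first.
  (* where the derivative does not exist, [lim] is [point = 0] *)
  by rewrite dvgP// normr0 ltW.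
have tD : \forall s \near t, 0 < s < T.
  have : t \in `]0, T[ by rewrite in_itv.
  by move=> /near_in_itvoo; apply: filterS => s; rewrite in_itv.
move: cF; set l := lim _ => Fl.
have {}Fl : diff_quotient F t @ t^' --> l.
  apply: cvg_trans Fl => B; rewrite !near_simpl !near_withinE => H.
  near=> s => st; have sD : 0 < s < T by near: s.
  have : s != t -> D' s -> B (diff_quotient F t s) by near: s.
  by apply => //; rewrite /D'/= in_itv/=; case/andP: sD => -> /ltW.
apply: (cvgr_to_le (cvg_norm Fl)).
rewrite !near_withinE; near=> s => st.
have sD : 0 < s < T by near: s.
rewrite /diff_quotient normrM normfV ler_pdivrMr ?normr_gt0 ?subr_eq0//.
exact: FM.
Unshelve. all: by end_near. Qed.

(** * Seminormed subspaces and Bochner integrals *)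

(** Function spaces are subsets of a space of representatives, so [N] is constrained on [X] only and
    may vanish at nonzero elements. *)
Definition seminormed {R : realType} {V : lmodType R} (X : set V) (N : V -> R) :=
  [/\ X 0, forall a x y, X x -> X y -> X (a *: x + y),
      forall x, X x -> 0 <= N x,
      forall a x, X x -> N (a *: x) = `|a| * N x
    & forall x y, X x -> X y -> N (x + y) <= N x + N y].

Section Seminormed.
Context {R : realType} {V : lmodType R} {X : set V} {N : V -> R}.
Hypothesis XN : seminormed X N.

Lemma semin0 : X 0. Proof. by case: XN. Qed.

Lemma seminZ a x : X x -> X (a *: x).
Proof.
by case: XN => X0 XZ _ _ _ Xx; rewrite -[_ *: x]addr0; exact: XZ.
Qed.

Lemma seminD x y : X x -> X y -> X (x + y).
Proof. by case: XN => _ XZ _ _ _ Xx Xy; rewrite -[x]scale1r; exact: XZ. Qed.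

Lemma seminB x y : X x -> X y -> X (x - y).
Proof.
by move=> Xx Xy; rewrite -scaleN1r; apply: seminD => //; exact: seminZ.
Qed.

Lemma semin_sum n (F : 'I_n -> V) : (forall i, X (F i)) -> X (\sum_(i < n) F i).
Proof. by move=> XF; elim/big_ind : _ => //; [exact: semin0|exact: seminD]. Qed.

Lemma semin_ge0 x : X x -> 0 <= N x. Proof. by case: XN => _ _ + _ _;
  apply. Qed.

Lemma seminN_Z a x : X x -> N (a *: x) = `|a| * N x.
Proof. by case: XN => _ _ _ + _; apply. Qed.

Lemma ler_seminD x y : X x -> X y -> N (x + y) <= N x + N y.
Proof. by case: XN => _ _ _ _; apply. Qed.

Lemma semin_norm0 : N 0 = 0.
Proof. by rewrite -[0](scale0r 0) seminN_Z ?normr0 ?mul0r//; exact: semin0. Qed.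

Lemma semin_normN x : X x -> N (- x) = N x.
Proof. by move=> Xx; rewrite -scaleN1r seminN_Z// normrN1 mul1r. Qed.

Lemma semin_distC x y : X x -> X y -> N (x - y) = N (y - x).
Proof. by move=> Xx Xy; rewrite -opprB semin_normN//; exact: seminB. Qed.

Lemma ler_semin_dist y x z : X x -> X y -> X z -> N (x - z) <= N (x - y) + N (y - z).
Proof.
move=> Xx Xy Xz; rewrite -[x - z](subrKA y).
by apply: ler_seminD; exact: seminB.
Qed.

Lemma sf_evalP (s : simple_fun X) t : X (sf_eval s t).
Proof. by apply: semin_sum => i; apply: seminZ; exact: sf_valP. Qed.

Lemma sf_integralP D (s : simple_fun X) : X (sf_integral D s).
Proof. by apply: semin_sum => i; apply: seminZ; exact: sf_valP. Qed.

End Seminormed.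

Lemma seminormed_norm (R : realType) :
  @seminormed R R^o [set: R] Num.norm.
Proof. by split => // [a x _|x y _ _]; [rewrite normrM|exact: ler_normD]. Qed.

(** Additivity and homogeneity hold up to [N']-null vectors only, which is all that maps defined by
    a choice of representatives satisfy. *)
Definition bounded_quasilinear {R : realType} {V W : lmodType R} (X : set V)
    (N : V -> R) (Y : set W) (N' : W -> R) (A : V -> W) (C : R) :=
  [/\ 0 < C, forall x, X x -> Y (A x),
      forall a x y, X x -> X y -> N' (A (a *: x + y) - (a *: A x + A y)) = 0
    & forall x, X x -> N' (A x) <= C * N x].

(** * Images of simple functions and Bochner integrals under bounded quasilinear maps *)

Section Push.
Context {R : realType} {V W : lmodType R} {X : set V} {N : V -> R}
  {Y : set W} {N' : W -> R} {A : V -> W} {C : R}.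
Hypotheses (XN : seminormed X N) (YN : seminormed Y N')
  (AC : bounded_quasilinear X N Y N' A C).

Let C0 : 0 < C. Proof. by case: AC. Qed.
Let AY x : X x -> Y (A x). Proof. by case: AC => _ + _ _; apply. Qed.
Let A0 : N' (A 0) = 0.
Proof.
have X0 := semin0 XN; apply/eqP; rewrite eq_le (semin_ge0 YN (AY X0)) andbT.
by case: AC => _ _ _ /(_ _ X0); rewrite (semin_norm0 XN) mulr0.
Qed.

Lemma quasilinear_lip x y : X x -> X y -> N' (A x - A y) <= C * N (x - y).
Proof.
move=> Xx Xy; have Xxy := seminB XN Xx Xy.
case: AC => _ _ /(_ 1 _ _ Xxy Xy) Alin /(_ _ Xxy) Abd.
apply: le_trans Abd; rewrite scale1r subrK scale1r in Alin.
apply: le_trans (ler_semin_dist YN (y := A (x - y) + A y) _ _ _) _;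
  rewrite ?Alin ?add0r ?addrK; try exact: AY.
- by apply: (seminD YN); exact: AY.
- by [].
Qed.

Lemma quasilinear_sum n (a : 'I_n -> R) (F : 'I_n -> V) :
  (forall i, X (F i)) ->
  N' (A (\sum_(i < n) a i *: F i) - \sum_(i < n) a i *: A (F i)) = 0.
Proof.
elim: n a F => [|n IHn] a F XF; first by rewrite !big_ord0 subr0.
rewrite !big_ord_recl /=.
set x := \sum_(i < n) _; set y := \sum_(i < n) _.
have Xx : X x by apply: (semin_sum XN) => i; exact: (seminZ XN).
have Yy : Y y by apply: (semin_sum YN) => i; apply: (seminZ YN); exact: AY.
have YF := AY (XF ord0).
have Xs : X (a ord0 *: F ord0 + x) by apply: (seminD XN) => //;
  exact: (seminZ XN).
have Ys z : Y z -> Y (a ord0 *: A (F ord0) + z).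
  by move=> Yz; apply: (seminD YN) => //; exact: (seminZ YN).
apply/eqP; rewrite eq_le; apply/andP; split; last first.
  by apply: (semin_ge0 YN); apply: (seminB YN); [exact: AY|exact: Ys].
apply: le_trans (ler_semin_dist YN (y := a ord0 *: A (F ord0) + A x) _ _ _) _.
- exact: AY.
- by apply: Ys; exact: AY.
- exact: Ys.
case: AC => _ _ /(_ (a ord0) _ _ (XF ord0) Xx) -> _.
by rewrite add0r opprD addrACA subrr add0r IHn.
Qed.

Definition sf_push (s : simple_fun X) : simple_fun Y :=
  @SimpleFun R W Y (sf_card s) (@sf_set _ _ _ s) (fun i => A (sf_val i))
    (@sf_measurable _ _ _ s) (fun i => AY (sf_valP i)).

Lemma sf_push_eval (s : simple_fun X) t z : X z ->
  N' (A z - sf_eval (sf_push s) t) <= C * N (z - sf_eval s t).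
Proof.
move=> Xz; have Xs := sf_evalP XN s t.
apply: le_trans (ler_semin_dist YN (y := A (sf_eval s t)) _ _ _) _;
  try exact: AY.
  exact: (sf_evalP YN).
rewrite [X in _ + X]quasilinear_sum ?addr0; first exact: quasilinear_lip.
by move=> i; exact: sf_valP.
Qed.

Lemma sf_push_integral (D : set R) (s : simple_fun X) z : X z ->
  N' (sf_integral D (sf_push s) - A z) <= C * N (sf_integral D s - z).
Proof.
move=> Xz; have Xs := sf_integralP XN D s.
have Ys := sf_integralP YN D (sf_push s).
apply: le_trans (ler_semin_dist YN (y := A (sf_integral D s)) _ _ _) _;
  try exact: AY.
  exact: Ys.
rewrite (semin_distC YN Ys (AY Xs)) [X in X + _]quasilinear_sum ?add0r.
  exact: quasilinear_lip.
by move=> i; exact: sf_valP.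
Qed.

Lemma strongly_measurable_push (D : set R) (f : R -> V) :
  (forall t, D t -> X (f t)) ->
  strongly_measurable X N D f -> strongly_measurable Y N' D (A \o f).
Proof.
move=> Xf [s sf]; exists (sf_push \o s) => t Dt.
apply: (@squeeze_cvgr _ _ _ _ (cst 0) (fun n => C * N (f t - sf_eval (s n) t))).
- apply: nearW => n; rewrite sf_push_eval ?andbT//; last exact: Xf.
  apply: (semin_ge0 YN); apply: (seminB YN); first by apply: AY; exact: Xf.
  exact: (sf_evalP YN).
- exact: cvg_cst.
- by rewrite -[0](mulr0 C); apply: cvgM; [exact: cvg_cst|exact: sf].
Qed.

Lemma L1norm_push_le (D B : set R) (f : R -> V) (g : R -> W) :
  (forall t, D t -> X (f t)) -> (forall t, D t -> Y (g t)) ->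
  measurable B -> lebesgue_measure B = 0%E ->
  (forall t, D t -> ~ B t -> N' (g t - A (f t)) = 0) ->
  (L1norm N' D g <= C%:E * L1norm N D f)%E.
Proof.
move=> Xf Yg mB B0 gAf; rewrite /L1norm;
  apply: (@ge0_le_ae_integral_mull _ _ _ lebesgue_measure _ B) => //.
- by move=> t /Yg Ygt; rewrite lee_fin; exact: (semin_ge0 YN).
- by move=> t /Xf Xft; rewrite lee_fin; exact: (semin_ge0 XN).
- move=> t Dt nBt; rewrite -EFinM lee_fin.
  have Xft := Xf _ Dt; have Ygt := Yg _ Dt.
  rewrite -[g t](subrK (A (f t))).
  apply: le_trans (ler_seminD YN _ _) _; [|exact: AY|].
    by apply: (seminB YN) => //; exact: AY.
  by rewrite gAf// add0r; case: AC => _ _ _; exact.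
Qed.

Lemma L1_push (D : set R) (f : R -> V) : L1 X N D f -> L1 Y N' D (A \o f).
Proof.
move=> [Xf sf foo]; split; first by move=> t /Xf; exact: AY.
  exact: strongly_measurable_push.
have : (L1norm N' D (A \o f) <= C%:E * L1norm N D f)%E.
  apply: (@L1norm_push_le _ set0) => //; first by move=> t /Xf; exact: AY.
  by move=> t /Xf Xft _; rewrite subrr; exact: (semin_norm0 YN).
move=> /le_lt_trans; apply; apply: lte_mul_pinfty => //.
by rewrite lee_fin ltW.
Qed.

(** The images under [A] of simple functions approximating [f] approximate [g], and their integrals
    are the images of the integrals up to null vectors. The slack between [g] and [A \o f], a null
    set of times and null vectors elsewhere, is what is available for the projection error. *)
Lemma bochner_push (D B : set R) (f : R -> V) (g : R -> W) (I : V) :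
  measurable B -> lebesgue_measure B = 0%E ->
  (forall t, D t -> Y (g t)) ->
  (forall t, D t -> ~ B t -> N' (g t - A (f t)) = 0) ->
  is_bochner_integral X N D f I -> is_bochner_integral Y N' D g (A I).
Proof.
move=> mB B0 Yg gAf [XI [Xf [s [sf sI]]]].
split; first exact: AY.
split => //; exists (sf_push \o s); split; last first.
  apply: (@squeeze_cvgr _ _ _ _ (cst 0) (fun n => C * N (sf_integral D (s n) - I))).
  - apply: nearW => n; rewrite sf_push_integral ?andbT//.
    apply: (semin_ge0 YN); apply: (seminB YN); first exact: (sf_integralP YN).
    exact: AY.
  - exact: cvg_cst.
  - by rewrite -[0](mulr0 C); apply: cvgM; [exact: cvg_cst|exact: sI].
pose r n t := f t - sf_eval (s n) t.
apply: (@squeeze_cvge _ _ _ _ (cst 0%E) _ (fun n => C%:E * L1norm N D (r n))%E).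
- apply: nearW => n; apply/andP; split.
    apply: integral_ge0 => t Dt; rewrite lee_fin; apply: (semin_ge0 YN).
    by apply: (seminB YN); [exact: Yg|exact: (sf_evalP YN)].
  rewrite /L1norm;
    apply: (@ge0_le_ae_integral_mull _ _ _ lebesgue_measure _ B) => //.
  + move=> t Dt; rewrite lee_fin; apply: (semin_ge0 YN).
    by apply: (seminB YN); [exact: Yg|exact: (sf_evalP YN)].
  + move=> t Dt; rewrite lee_fin; apply: (semin_ge0 XN).
    by apply: (seminB XN); [exact: Xf|exact: (sf_evalP XN)].
  + move=> t Dt nBt; rewrite -EFinM lee_fin.
    apply: le_trans (ler_semin_dist YN (y := A (f t)) _ _ _) _.
    * exact: Yg.
    * by apply: AY; exact: Xf.
    * exact: (sf_evalP YN).
    by rewrite gAf// add0r; apply: sf_push_eval; exact: Xf.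
- exact: cvg_cst.
- have Cf : C%:E \is a fin_num by [].
  by have := cvgeZl Cf sf; rewrite mule0.
Qed.

End Push.

Section StronglyMeasurable.
Context {R : realType} {V : lmodType R} {X : set V} {N : V -> R}.
Hypothesis XN : seminormed X N.

Lemma quasilinear_opp : bounded_quasilinear X N X N -%R 1.
Proof.
split => // [x Xx|a x y Xx Xy|x Xx].
- by rewrite -scaleN1r; exact: (seminZ XN).
- by rewrite opprD scalerN subrr (semin_norm0 XN).
- by rewrite (semin_normN XN)// mul1r.
Qed.

(** The sets of a simple function may overlap, so a sum is obtained by listing the terms of both,
    without a common refinement. *)
Definition sf_cat (s s' : simple_fun X) : simple_fun X :=
  @SimpleFun R V X (sf_card s + sf_card s')
    (fun i => match fintype.split i with inl j => sf_set j | inr j => sf_set j end)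
    (fun i => match fintype.split i with inl j => sf_val j | inr j => sf_val j end)
    (fun i => match fintype.split i as k return measurable
       (match k with inl j => sf_set j | inr j => sf_set j end) with
       inl j => sf_measurable j | inr j => sf_measurable j end)
    (fun i => match fintype.split i as k return X
       (match k with inl j => sf_val j | inr j => sf_val j end) with
       inl j => sf_valP j | inr j => sf_valP j end).

Lemma sf_cat_eval (s s' : simple_fun X) t :
  sf_eval (sf_cat s s') t = sf_eval s t + sf_eval s' t.
Proof.
rewrite /sf_eval big_split_ord/=; congr (_ + _); apply: eq_bigr => i _.
  by rewrite -[lshift _ i]/(unsplit (inl i)) unsplitK.
by rewrite -[rshift _ i]/(unsplit (inr i)) unsplitK.
Qed.

Lemma strongly_measurableB (D : set R) (f g : R -> V) :
  (forall t, D t -> X (f t)) -> (forall t, D t -> X (g t)) ->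
  strongly_measurable X N D f -> strongly_measurable X N D g ->
  strongly_measurable X N D (fun t => f t - g t).
Proof.
move=> Xf Xg [s sf].
move=> /(strongly_measurable_push XN XN quasilinear_opp Xg)[s' sg].
exists (fun n => sf_cat (s n) (s' n)) => t Dt.
have Xft := Xf _ Dt; have Xgt := Xg _ Dt.
have Xs n := sf_evalP XN (s n) t; have Xs' n := sf_evalP XN (s' n) t.
have XNg : X (- g t) by rewrite -scaleN1r; exact: (seminZ XN).
apply: (@squeeze_cvgr _ _ _ _ (cst 0)
    (fun n => N (f t - sf_eval (s n) t) + N (- g t - sf_eval (s' n) t))).
- apply: nearW => n; rewrite sf_cat_eval opprD addrACA; apply/andP; split.
    by apply: (semin_ge0 XN); apply: (seminD XN); exact: (seminB XN).
  by apply: (ler_seminD XN); exact: (seminB XN).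
- exact: cvg_cst.
- by rewrite -[0](addr0 0); apply: cvgD; [exact: sf|exact: sg].
Qed.

Lemma strongly_measurable_sub {Y : set V} {N' : V -> R} {C : R} (D : set R)
    (f : R -> V) : seminormed Y N' ->
  0 < C -> X `<=` Y -> (forall x, X x -> N' x <= C * N x) ->
  (forall t, D t -> X (f t)) ->
  strongly_measurable X N D f -> strongly_measurable Y N' D f.
Proof.
move=> YN C0 XY NC Xf;
  apply: (@strongly_measurable_push _ _ _ X N Y N' id C) => //.
by split => // a x y Xx Xy; rewrite subrr (semin_norm0 YN).
Qed.

End StronglyMeasurable.

Lemma strongly_measurable_real (R : realType) (D : set R) (f : R -> R) :
  measurable D -> @strongly_measurable R R^o [set: R] Num.norm D f ->
  measurable_fun D f.
Proof.
move=> mD [s sf]; apply: (@measurable_fun_cvg _ _ _ _ (fun n => sf_eval (s n))).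
  move=> n; apply: measurable_sum => i; apply: measurable_funM => //.
  by apply: measurable_funTS; apply: measurable_indic; exact: sf_measurable.
move=> t Dt; apply/cvgrPdist_le => e e0.
have /cvgrPdist_le/(_ _ e0) := sf t Dt.
by apply: filterS => n; rewrite sub0r normrN normr_id.
Qed.

(** * Semi-inner products *)

Definition semi_inner {R : realType} {V : lmodType R} (X : set V)
    (B : V -> V -> R) :=
  [/\ X 0, forall a x y, X x -> X y -> X (a *: x + y),
      forall a x y z, X x -> X y -> X z -> B (a *: x + y) z = a * B x z + B y z,
      forall x y, X x -> X y -> B x y = B y x & forall x, X x -> 0 <= B x x].

Section SemiInner.
Context {R : realType} {V : lmodType R} {X : set V} {B : V -> V -> R}.
Hypothesis XB : semi_inner X B.

Let X0 : X 0. Proof. by case: XB. Qed.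
Let XZD a x y : X x -> X y -> X (a *: x + y).
Proof. by case: XB => _ + _ _ _; exact. Qed.
Let BZD a x y z : X x -> X y -> X z -> B (a *: x + y) z = a * B x z + B y z.
Proof. by case: XB => _ _ + _ _; exact. Qed.
Let BC x y : X x -> X y -> B x y = B y x.
Proof. by case: XB => _ _ _ + _; exact. Qed.
Let Bge0 x : X x -> 0 <= B x x.
Proof. by case: XB => _ _ _ _; exact. Qed.

Lemma semi_innerD x y z : X x -> X y -> X z -> B (x + y) z = B x z + B y z.
Proof. by move=> Xx Xy Xz; rewrite -[x]scale1r BZD// scale1r mul1r. Qed.

Lemma semi_inner0 z : X z -> B 0 z = 0.
Proof.
move=> Xz; have := BZD 1 X0 X0 Xz.
by rewrite scale1r addr0 mul1r; lra.
Qed.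

Lemma semi_innerZ a x z : X x -> X z -> B (a *: x) z = a * B x z.
Proof. by move=> Xx Xz; rewrite -[a *: x]addr0 BZD// semi_inner0// addr0. Qed.

Lemma semi_inner_sqr a x y : X x -> X y ->
  B (a *: x + y) (a *: x + y) = a ^+ 2 * B x x + 2 * a * B x y + B y y.
Proof.
move=> Xx Xy; have Xs := XZD a Xx Xy.
by rewrite BZD// (BC Xx Xs) (BC Xy Xs) !BZD// (BC Xy Xx); ring.
Qed.

(** The quadratic [a |-> B (a *: x + y) (a *: x + y)] is nonnegative; it is evaluated at its
    minimizer, or, when [B x x = 0] makes it affine, at a point that forces its slope to vanish. *)
Lemma semi_inner_CS x y : X x -> X y ->
  `|B x y| <= Num.sqrt (B x x) * Num.sqrt (B y y).
Proof.
move=> Xx Xy; rewrite -sqrtrM ?Bge0// -sqrtr_sqr ler_sqrt ?mulr_ge0 ?Bge0//.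
have H a : 0 <= a ^+ 2 * B x x + 2 * a * B x y + B y y.
  by rewrite -semi_inner_sqr//; apply: Bge0; exact: XZD.
have xx := Bge0 Xx; have yy := Bge0 Xy.
have [x0|xn0] := eqVneq (B x x) 0.
  have [->|b0] := eqVneq (B x y) 0; first by rewrite expr0n mulr_ge0.
  (* At this [a] the affine function takes the value [-1]. *)
  have := H (- (B y y + 1) / (2 * B x y)); rewrite x0 mulr0 add0r.
  have -> : 2 * (- (B y y + 1) / (2 * B x y)) * B x y = - (B y y + 1) by field.
  by lra.
have x0 : 0 < B x x by rewrite lt_neqAle eq_sym xn0.
have := H (- B x y / B x x).
have -> : (- B x y / B x x) ^+ 2 * B x x + 2 * (- B x y / B x x) * B x y + B y y
  = (B x x * B y y - B x y ^+ 2) / B x x by field.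
by rewrite pmulr_lge0 ?invr_gt0// subr_ge0.
Qed.

Lemma semi_inner_seminormed : seminormed X (fun x => Num.sqrt (B x x)).
Proof.
split => // [a x Xx|x y Xx Xy].
  have -> : B (a *: x) (a *: x) = a ^+ 2 * B x x.
    have := semi_inner_sqr a Xx X0; rewrite addr0 => ->.
    by rewrite (BC Xx X0) !semi_inner0//; ring.
  by rewrite sqrtrM ?sqr_ge0// sqrtr_sqr.
have := semi_inner_sqr 1 Xx Xy; rewrite scale1r expr1n mul1r mulr1 => ->.
rewrite -[leRHS]ger0_norm ?addr_ge0 ?sqrtr_ge0// -sqrtr_sqr.
rewrite ler_sqrt ?sqr_ge0// sqrrD !sqr_sqrtr ?Bge0// lerD2r lerD2l.
have := ler_normlW (semi_inner_CS Xx Xy); lra.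
Qed.

Lemma semi_inner_null x y : X x -> X y -> B x x = 0 -> B x y = 0.
Proof.
move=> Xx Xy x0; have := semi_inner_CS Xx Xy.
by rewrite x0 sqrtr0 mul0r normr_le0 => /eqP.
Qed.

End SemiInner.

(** By Cauchy-Schwarz a null vector is orthogonal to everything, so the pulled-back form is exactly
    bilinear although [A] is linear only up to null vectors. *)
Lemma semi_inner_pullback {R : realType} {V W : lmodType R} (X : set V)
    (Y : set W) (B : W -> W -> R) (A : V -> W) :
  semi_inner Y B -> X 0 -> (forall a x y, X x -> X y -> X (a *: x + y)) ->
  (forall x, X x -> Y (A x)) ->
  (forall a x y, X x -> X y ->
    let z := A (a *: x + y) - (a *: A x + A y) in B z z = 0) ->
  semi_inner X (fun x y => B (A x) (A y)).
Proof.
move=> YB X0 XZD XY Alin; split => // [a x y z Xx Xy Xz|x y Xx Xy|x Xx].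
- have YNB := semi_inner_seminormed YB.
  have Yx := XY _ Xx; have Yy := XY _ Xy; have Yz := XY _ Xz.
  have Yxy := XY _ (XZD a _ _ Xx Xy).
  have Yl : Y (a *: A x + A y) by case: YB => _ + _ _ _; exact.
  have := semi_inner_null YB (seminB YNB Yxy Yl) Yz (Alin a _ _ Xx Xy).
  rewrite addrC -scaleN1r.
  have -> : B (-1 *: (a *: A x + A y) + A (a *: x + y)) (A z) =
     -1 * B (a *: A x + A y) (A z) + B (A (a *: x + y)) (A z).
    by case: YB => _ _ + _ _; exact.
  have -> : B (a *: A x + A y) (A z) = a * B (A x) (A z) + B (A y) (A z).
    by case: YB => _ _ + _ _; exact.
  by lra.
- by case: YB => _ _ _ + _; apply; exact: XY.
- by case: YB => _ _ _ _; apply; exact: XY.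
Qed.

Lemma semi_inner_sum {R : realType} {V : lmodType R} (X : set V) n
    (c : 'I_n -> R) (B : 'I_n -> V -> V -> R) :
  X 0 -> (forall a x y, X x -> X y -> X (a *: x + y)) ->
  (forall i, 0 <= c i) -> (forall i, semi_inner X (B i)) ->
  semi_inner X (fun x y => \sum_(i < n) c i * B i x y).
Proof.
move=> X0 XZD c0 XB; split => // [a x y z Xx Xy Xz|x y Xx Xy|x Xx].
- rewrite mulr_sumr -big_split; apply: eq_bigr => i _ /=.
  by case: (XB i) => _ _ -> // _ _; ring.
- by apply: eq_bigr => i _; case: (XB i) => _ _ _ -> .
- apply: sumr_ge0 => i _; rewrite mulr_ge0//.
  by case: (XB i) => _ _ _ _; exact.
Qed.

Lemma semi_innerDform {R : realType} {V : lmodType R} (X : set V)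
    (B B' : V -> V -> R) :
  semi_inner X B -> semi_inner X B' -> semi_inner X (fun x y => B x y + B' x y).
Proof.
move=> [X0 XZD BZ BC B0] [_ _ BZ' BC' B0'];
  split => // [a x y z Xx Xy Xz|x y Xx Xy|x Xx].
- by rewrite BZ// BZ'//; ring.
- by rewrite BC// BC'.
- by rewrite addr_ge0 ?B0 ?B0'.
Qed.

(** * The spaces L^2, H^1 and the spectral scale *)

Section L2space.
Context {R : realType} {d : nat}.
Local Notation E := 'rV[R]_d.
Variables (mu : {measure set (borel_rV R d) -> \bar R}) (Omega : set E).
Hypothesis oOmega : open Omega.

Lemma open_measurable_rV (U : set E) :
  open U -> measurable (U : set (borel_rV R d)).
Proof. exact: sub_sigma_algebra. Qed.

Let mOmega : measurable (Omega : set (borel_rV R d)).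
Proof. exact: open_measurable_rV. Qed.

(** A bounded set lies in a cube, whose measure is prescribed. Finite measure is what puts test
    functions into L^2. *)
Lemma bounded_measure_fin : is_lebesgue mu -> bounded_set Omega ->
  (mu Omega < +oo)%E.
Proof.
move=> hmu [M [_ /(_ (M + 1))]]; rewrite ltrDl ltr01 => /(_ isT) OM.
pose b : E := const_mx (`|M| + 1).
pose B : set E := [set x | forall i, (- b) ord0 i <= x ord0 i <= b ord0 i].
have mB : measurable (B : set (borel_rV R d)).
  rewrite -[B]setCK; apply: measurableC; apply: open_measurable_rV.
  rewrite openC (_ : B = \bigcap_(i in [set: 'I_d])
    ((fun x : E => x ord0 i) @^-1` [set` `[- (`|M| + 1), `|M| + 1]])).
    apply: closed_bigI => i _; apply: closed_comp; last exact: itv_closed.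
    by move=> x _; exact: coord_continuous.
  apply/seteqP; split => x /= H i; first by move=> _; have := H i;
    rewrite /= in_itv/= !mxE.
  by have := H i Logic.I; rewrite /= in_itv/= !mxE.
apply: (@le_lt_trans _ _ (mu B)).
  apply: le_measure; rewrite ?inE//.
  move=> x /OM xM i; rewrite !mxE -ler_norml.
  apply: (@le_trans _ _ `|x|).
    rewrite {2}/Num.norm/= mx_normrE.
    exact: (@le_bigmax _ _ _ 0 (fun ij => `|x ij.1 ij.2|) (ord0, i)).
  by apply: (le_trans xM); rewrite lerD2r ler_norm.
rewrite hmu ?ltry// => i; rewrite !mxE.
by rewrite -subr_ge0 opprK !addr_ge0.
Qed.

Local Notation L2 := (L2 mu Omega).
Local Notation ip := (ip mu Omega).
Local Notation L2norm := (L2norm mu Omega).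

Let sqr_integrable (f : E -> R) : L2 f ->
  mu.-integrable Omega (fun x => ((f x) ^+ 2)%:E).
Proof.
move=> [mf foo]; apply/integrableP; split.
  exact/measurable_EFinP/measurable_funX.
by under eq_integral do rewrite gee0_abs ?lee_fin ?sqr_ge0//.
Qed.

Let mul_integrable (f g : E -> R) : L2 f -> L2 g ->
  mu.-integrable Omega (EFin \o (fun x => f x * g x)).
Proof.
move=> Lf Lg; apply: (@le_integrable _ (borel_rV R d) _ mu Omega mOmega _
    (fun x => ((f x) ^+ 2)%:E + ((g x) ^+ 2)%:E)%E).
- by apply/measurable_EFinP/measurable_funM; [case: Lf|case: Lg].
- move=> x _; rewrite /= lee_fin [leRHS]ger0_norm ?addr_ge0 ?sqr_ge0//.
  rewrite ler_norml; apply/andP; split; nra.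
- by apply: integrableD => //; exact: sqr_integrable.
Qed.

Lemma L2_semi_inner : semi_inner L2 ip.
Proof.
have L20 : L2 0.
  split; first exact: measurable_cst.
  by under eq_integral do rewrite expr0n; rewrite integral0.
split => //.
- move=> a f g Lf Lg; split.
    have [mf _] := Lf; have [mg _] := Lg.
    by apply: measurable_funD => //; exact: measurable_funM.
  apply: (@le_lt_trans _ _ (\int[mu]_(x in Omega)
    ((2 * a ^+ 2)%:E * ((f x) ^+ 2)%:E + 2%:E * ((g x) ^+ 2)%:E))%E).
    rewrite -[leRHS]mul1e; apply: ge0_le_integral_mull => //.
    + by move=> x _; rewrite lee_fin sqr_ge0.
    + by move=> x _; rewrite -!EFinM -EFinD lee_fin; have := sqr_ge0 (a * f x);
      have := sqr_ge0 (g x); nra.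
    + move=> x _;
      rewrite mul1e -!EFinM -EFinD lee_fin (_ : (a *: f + g) x = a * f x + g x)//.
      by have := sqr_ge0 (a * f x - g x); nra.
  rewrite -ge0_fin_numE; last first.
    apply: integral_ge0 => x _.
    rewrite -!EFinM -EFinD lee_fin.
    by have := sqr_ge0 (a * f x); have := sqr_ge0 (g x); nra.
  apply: integrable_fin_num => //; apply: integrableD => //;
    apply: integrableZl => //; exact: sqr_integrable.
- move=> a f g k Lf Lg Lk; rewrite /Defs.ip.
  under eq_Rintegral do rewrite mulrDl -mulrA.
  rewrite RintegralD//;
    [|exact: (integrableZl mOmega a (mul_integrable Lf Lk))|exact: mul_integrable].
  by rewrite RintegralZl//; exact: mul_integrable.
- by move=> f g _ _; apply: eq_Rintegral => x _; rewrite mulrC.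
- by move=> f _; apply: Rintegral_ge0 => x _; rewrite -expr2 sqr_ge0.
Qed.

Lemma continuous_compact_support_L2 (A : set E) (f : E -> R) :
  (mu Omega < +oo)%E -> continuous f -> compact A ->
  (forall x, ~ A x -> f x = 0) -> L2 f.
Proof.
move=> muO cf cA fA; split.
  apply: (@measurability _ _ (borel_rV R d) _ Omega f _ (RGenOInfty.measurableE R)).
  move=> _ [_ [a -> <-]]; apply: measurableI => //.
  apply: open_measurable_rV; move/continuousP : cf; apply.
  exact: interval_open.
have [M [_ /(_ (M + 1))]] := compact_bounded (continuous_compact (continuous_subspaceT cf) cA).
rewrite ltrDl ltr01 => /(_ isT) fM.
have fM' x : `|f x| <= `|M| + 1.
  have [Ax|/fA ->] := pselect (A x); last by rewrite normr0 addr_ge0.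
  apply: (@le_trans _ _ (M + 1)); last by rewrite lerD2r ler_norm.
  by apply: fM; exists x.
apply: (@le_lt_trans _ _ (\int[mu]_(x in Omega) (cst ((`|M| + 1) ^+ 2)%:E x))%E).
  rewrite -[leRHS]mul1e; apply: ge0_le_integral_mull => //.
  + by move=> x _; rewrite lee_fin sqr_ge0.
  + by move=> x _; rewrite lee_fin sqr_ge0.
  + move=> x _; rewrite mul1e lee_fin -real_normK ?num_real//.
    by rewrite lerXn2r ?nnegrE ?addr_ge0.
by rewrite integral_cst// lte_mul_pinfty// lee_fin sqr_ge0.
Qed.

End L2space.

Lemma cst_cvg0 (R : realType) (a : R) : (fun=> a : R) @ \oo --> (0 : R) -> a = 0.
Proof. by move=> /(cvg_lim (@Rhausdorff R)); rewrite lim_cst//;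
  exact: Rhausdorff. Qed.

Section Sobolev.
Context {R : realType} {d : nat}.
Local Notation E := 'rV[R]_d.
Variables (mu : {measure set (borel_rV R d) -> \bar R}) (Omega : set E).
Hypotheses (oOmega : open Omega) (muO : (mu Omega < +oo)%E).
Variables (K : R) (lam : nat -> R) (phi : nat -> E -> R).
Hypotheses (hK : 0 < K) (heig : dirichlet_eigenpairs mu Omega K lam phi).

Local Notation L2 := (L2 mu Omega).
Local Notation ip := (ip mu Omega).
Local Notation L2norm := (L2norm mu Omega).
Local Notation H1 := (H1 mu Omega).
Local Notation H10 := (H10 mu Omega).
Local Notation H1norm := (H1norm mu Omega).
Local Notation aform := (aform mu Omega K).
Local Notation wpartial := (wpartial mu Omega).
Local Notation weak_partial := (weak_partial mu Omega).

Let L2ip : semi_inner L2 ip := L2_semi_inner mu oOmega.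
Let L2N : seminormed L2 L2norm := semi_inner_seminormed L2ip.

Lemma L2norm_sqr f : L2 f -> L2norm f ^+ 2 = ip f f.
Proof. by move=> Lf; rewrite sqr_sqrtr//; case: L2ip => _ _ _ _; exact. Qed.

Lemma L2norm_le_H1norm f : L2norm f <= H1norm f.
Proof.
rewrite -[leLHS]ger0_norm ?sqrtr_ge0// -sqrtr_sqr ler_sqrt.
  by rewrite lerDl sumr_ge0// => i _; exact: sqr_ge0.
by rewrite addr_ge0 ?sqr_ge0// sumr_ge0// => i _; exact: sqr_ge0.
Qed.

Lemma test_L2 psi : test Omega psi -> L2 psi.
Proof.
move=> [spsi [A [cA _ psiA]]].
apply: (continuous_compact_support_L2 oOmega muO _ cA psiA).
by case: (spsi 0%N).
Qed.

Lemma test_derive_L2 psi i : test Omega psi ->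
  L2 (fun x => 'D_(delta_mx 0 i) psi x).
Proof.
move=> [spsi [A [cA _ psiA]]].
apply: (continuous_compact_support_L2 oOmega muO _ cA).
  by case: (spsi 1%N) => _ /(_ i) [_ []].
move=> x nAx; rewrite (@near_eq_derive _ _ _ _ (cst 0)) ?derive_cst//.
have oA : open (~` A) by apply: closed_openC; apply: compact_closed => //;
  exact: norm_hausdorff.
have : nbhs x (~` A) by exact: open_nbhs_nbhs.
by apply: filterS => y /psiA.
Qed.

(* The eigenfunctions are complete in L^2, and each is an L^2 limit of test
   functions because it lies in H^1_0. *)
Lemma L2_test_dense g : L2 g -> (forall psi, test Omega psi -> ip g psi = 0) ->
  L2norm g = 0.
Proof.
move=> Lg gtest; case: heig => _ _ eigH10 _ basis.
have gphi k : ip g (phi k) = 0.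
  have [[[Lphi _] [psi [tpsi cpsi]]] _] := eigH10 k.
  apply/eqP; rewrite -normr_le0.
  have H n : `|ip g (phi k)| <= L2norm g * H1norm (psi n - phi k).
    have Lpsi := test_L2 (tpsi n).
    have Ld := seminB L2N Lpsi Lphi.
    apply: (@le_trans _ _ (L2norm g * L2norm (psi n - phi k))).
      have := semi_inner_CS L2ip Lg Ld.
      have -> : ip g (psi n - phi k) = - ip g (phi k).
        rewrite -scaleN1r addrC.
        case: L2ip => _ _ ipZ ipC _.
        by rewrite ipC// ?(addrC _ (psi n)) ?scaleN1r// -scaleN1r (addrC (psi n)) ipZ// (ipC _ _ Lpsi Lg) gtest// addr0 mulN1r ipC.
      by rewrite normrN.
    by rewrite ler_wpM2l ?sqrtr_ge0// L2norm_le_H1norm.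
  have cv : (fun n => L2norm g * H1norm (psi n - phi k)) @ \oo --> (0 : R).
    by rewrite -(mulr0 (L2norm g)); apply: cvgM => //; exact: cvg_cst.
  by apply: (cvgr_to_ge cv); apply: nearW => n; exact: H.
have := basis _ Lg.
under eq_fun do under eq_bigr do rewrite gphi scale0r.
under eq_fun do rewrite big1// subr0.
exact: cst_cvg0.
Qed.

Lemma weak_partialP i f : H1 f -> weak_partial i f (wpartial i f).
Proof.
by move=> [_ /(_ i)[g gP]]; apply: (@getPex _ (weak_partial i f)); exists g.
Qed.

Lemma wpartial_L2 i f : H1 f -> L2 (wpartial i f).
Proof. by move=> /(weak_partialP i)[]. Qed.

Lemma weak_partial_lin i a f f' g g' : L2 f -> L2 f' ->
  weak_partial i f g -> weak_partial i f' g' ->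
  weak_partial i (a *: f + f') (a *: g + g').
Proof.
move=> Lf Lf' [Lg Hg] [Lg' Hg']; split.
  by case: L2ip => _ + _ _ _; exact.
move=> psi tpsi; have Lpsi := test_L2 tpsi; have Ld := test_derive_L2 i tpsi.
by case: L2ip => _ _ ipZ _ _; rewrite !ipZ// Hg// Hg'//; ring.
Qed.

(** The difference is orthogonal to all test functions, hence null by [L2_test_dense]. This makes
    the selected derivative [wpartial] linear up to null functions, so that the energy form is
    bilinear. *)
Lemma weak_partial_unique i f g g' :
  weak_partial i f g -> weak_partial i f g' -> ip (g - g') (g - g') = 0.
Proof.
move=> [Lg Hg] [Lg' Hg']; have Ld := seminB L2N Lg Lg'.
rewrite -L2norm_sqr// L2_test_dense ?expr0n// => psi tpsi.
have Lpsi := test_L2 tpsi.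
rewrite addrC -scaleN1r; case: L2ip => _ _ ipZ _ _; rewrite ipZ//.
by have := Hg _ tpsi; have := Hg' _ tpsi; lra.
Qed.

Lemma H1_lin a f g : H1 f -> H1 g -> H1 (a *: f + g).
Proof.
move=> Hf Hg; split.
  by case: L2ip => _ + _ _ _; apply; [case: Hf|case: Hg].
move=> i; exists (a *: wpartial i f + wpartial i g).
by apply: weak_partial_lin;
  [case: Hf|case: Hg|exact: weak_partialP|exact: weak_partialP].
Qed.

Lemma H1_0 : H1 0.
Proof.
have L0 : L2 0 by case: L2ip.
split => // i; exists 0; split => // psi tpsi.
rewrite !(semi_inner0 L2ip) ?oppr0//; first exact: test_L2.
exact: test_derive_L2.
Qed.

Let partial_semi_inner i :
  semi_inner H1 (fun f g => ip (wpartial i f) (wpartial i g)).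
Proof.
apply: (semi_inner_pullback L2ip H1_0 H1_lin); first by move=> f;
  exact: wpartial_L2.
move=> a f g Hf Hg /=; apply: (@weak_partial_unique i (a *: f + g)).
  by apply: weak_partialP; exact: H1_lin.
by apply: weak_partial_lin;
  [case: Hf|case: Hg|exact: weak_partialP|exact: weak_partialP].
Qed.

Lemma aform_semi_inner : semi_inner H1 aform.
Proof.
have -> : aform = fun f g => \sum_(i < d) K * ip (wpartial i f) (wpartial i g).
  by apply/funext => f; apply/funext => g; rewrite /Defs.aform mulr_sumr.
apply: (@semi_inner_sum _ _ H1 _ (fun=> K));
  [exact: H1_0|exact: H1_lin| |by []].
by move=> _; exact: ltW.
Qed.

Let L2ip_H1 : semi_inner H1 ip.
Proof.
apply: (semi_inner_pullback L2ip H1_0 H1_lin (A := id)); first by move=> f [].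
move=> a f g [Lf _] [Lg _] /=; rewrite subrr; rewrite (semi_inner0 L2ip)//.
by case: L2ip.
Qed.

Lemma H1norm_seminormed : seminormed H1 H1norm.
Proof.
have S : semi_inner H1 (fun f g =>
    ip f g + \sum_(i < d) 1 * ip (wpartial i f) (wpartial i g)).
  apply: semi_innerDform L2ip_H1 _.
  by apply: (@semi_inner_sum _ _ H1 _ (fun=> 1));
    [exact: H1_0|exact: H1_lin| |].
have [h0 hZ hge hN hD] := semi_inner_seminormed S.
have NE f : H1 f -> H1norm f =
    Num.sqrt (ip f f + \sum_(i < d) 1 * ip (wpartial i f) (wpartial i f)).
  move=> Hf; rewrite /Defs.H1norm L2norm_sqr; last by case: Hf.
  congr (Num.sqrt (_ + _)); apply: eq_bigr => i _.
  by rewrite mul1r L2norm_sqr//; exact: wpartial_L2.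
have NZ a f : H1 f -> H1 (a *: f).
  by move=> Hf; rewrite -[_ *: f]addr0; apply: H1_lin => //; exact: H1_0.
have ND f g : H1 f -> H1 g -> H1 (f + g).
  by move=> Hf Hg; rewrite -[f]scale1r; exact: H1_lin.
split => //.
- by move=> f _; exact: sqrtr_ge0.
- by move=> a f Hf; rewrite (NE _ Hf) (NE _ (NZ a _ Hf)); exact: hN.
- by move=> f g Hf Hg; rewrite (NE _ Hf) (NE _ Hg) (NE _ (ND _ _ Hf Hg));
  exact: hD.
Qed.

Lemma aform_le_H1norm f : H1 f -> Num.sqrt (aform f f) <= Num.sqrt K * H1norm f.
Proof.
move=> Hf; rewrite /Defs.H1norm -sqrtrM; last exact: ltW.
rewrite ler_sqrt; last first.
  rewrite mulr_ge0 ?(ltW hK)// addr_ge0 ?sqr_ge0// sumr_ge0// => i _.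
  exact: sqr_ge0.
rewrite ler_wpM2l ?(ltW hK)// -[leLHS]add0r lerD ?sqr_ge0//.
by apply: ler_sum => i _; rewrite L2norm_sqr//; exact: wpartial_L2.
Qed.

(* The weak eigenvalue identity extends from H^1_0 to its linear span, which is
  all that the argument needs: H^1_0 itself is never shown to be a subspace. *)
Definition eig_class (f : E -> R) : Prop :=
  H1 f /\ forall i, aform (phi i) f = lam i ^+ 2 * ip (phi i) f.

Lemma H10_eig_class f : H10 f -> eig_class f.
Proof.
move=> Hf; split; first by case: Hf.
by case: heig => _ _ eigH10 _ _ i; have [_] := eigH10 i; exact.
Qed.

Let phi_H1 i : H1 (phi i).
Proof. by case: heig => _ _ /(_ i)[[]]. Qed.

Lemma eig_class_lin a f g : eig_class f -> eig_class g ->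
  eig_class (a *: f + g).
Proof.
move=> [Hf ef] [Hg eg]; split; first exact: H1_lin.
move=> i; have Hs := H1_lin a Hf Hg.
have [_ _ ipZ ipC _] := L2ip; have [_ _ aZ aC _] := aform_semi_inner.
have [Lp _] := phi_H1 i; have [Lf _] := Hf; have [Lg _] := Hg;
  have [Ls _] := Hs.
by rewrite aC// aZ// ipC// ipZ// (aC _ _ Hf)// (aC _ _ Hg)// (ipC _ _ Lf)//
  (ipC _ _ Lg)// ef eg; ring.
Qed.

Lemma eig_class0 : eig_class 0.
Proof.
split=> [|i]; first exact: H1_0.
have [L0 _ _ ipC _] := L2ip; have [Lp _] := phi_H1 i.
have [a0 _ _ aC _] := aform_semi_inner.
by rewrite aC// ipC// (semi_inner0 aform_semi_inner)// (semi_inner0 L2ip)// mulr0.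
Qed.

(** Bessel's inequality for the energy form: the truncated eigenfunction expansion [p n] satisfies
    [a(p n, f) = a(p n, p n) = S], so [0 <= a(f - p n, f - p n) = a(f, f) - S]. *)
Lemma eig_class_bessel f n : eig_class f ->
  \sum_(i < n) lam i ^+ 2 * ip f (phi i) ^+ 2 <= aform f f.
Proof.
move=> [Hf ef]; have [h0 hZD aZ aC age] := aform_semi_inner.
have [_ _ _ ipC _] := L2ip; have [Lf _] := Hf.
pose c (i : nat) := ip f (phi i).
pose p m := \sum_(i < m) c i *: phi i.
have Hp m : H1 (p m).
  by apply: (semin_sum H1norm_seminormed) => i;
    apply: (seminZ H1norm_seminormed).
have aphi i g : H1 g -> aform (phi i) g = aform g (phi i) by move=> Hg;
  rewrite aC.
have aphif i : aform (phi i) f = lam i ^+ 2 * c i.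
  by rewrite ef /c ipC//; case: (phi_H1 i).
have aphiphi i j : aform (phi i) (phi j) = lam i ^+ 2 * (i == j)%:R.
  case: heig => _ _ eigH10 orth _; rewrite -orth.
  by have [_] := eigH10 i; apply; have [] := eigH10 j.
have apg m g : H1 g -> aform (p m) g = \sum_(i < m) c i * aform (phi i) g.
  move=> Hg; rewrite /p; elim: m => [|m IHm].
    by rewrite !big_ord0 (semi_inner0 aform_semi_inner).
  by rewrite !big_ord_recr/= addrC aZ ?IHm ?(addrC (c m * _))//; exact: Hp.
pose S := \sum_(i < n) lam i ^+ 2 * c i ^+ 2.
have apf : aform (p n) f = S.
  by rewrite apg//; apply: eq_bigr => i _; rewrite aphif; ring.
have app : aform (p n) (p n) = S.
  rewrite apg//; apply: eq_bigr => i _; rewrite aphi// apg//.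
  rewrite (bigD1 i)//= big1 ?addr0.
    by rewrite aphiphi eqxx mulr1; ring.
  move=> j ji; rewrite aphiphi (_ : (j == i :> nat) = false) ?mulr0//.
  exact/negbTE.
have := age _ (hZD (-1) _ _ (Hp n) Hf).
rewrite (semi_inner_sqr aform_semi_inner (-1) (Hp n) Hf) app apf -/S.
by move: S (aform f f) {apf app} => S b; lra.
Qed.

End Sobolev.

(** * The spectral norms *)

Section Hdot.
Context {R : realType} {d : nat}.
Local Notation E := 'rV[R]_d.
Variables (mu : {measure set (borel_rV R d) -> \bar R}) (Omega : set E).
Hypotheses (oOmega : open Omega) (muO : (mu Omega < +oo)%E).
Variables (K : R) (lam : nat -> R) (phi : nat -> E -> R).
Hypotheses (hK : 0 < K) (heig : dirichlet_eigenpairs mu Omega K lam phi).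

Local Notation L2 := (L2 mu Omega).
Local Notation ip := (ip mu Omega).
Local Notation Hdot := (Hdot mu Omega lam phi).
Local Notation Hdot_norm := (Hdot_norm mu Omega lam phi).
Local Notation Hdot_sqnorm := (Hdot_sqnorm mu Omega lam phi).
Local Notation eig_class := (eig_class mu Omega K lam phi).
Local Notation aform := (aform mu Omega K).

Let L2ip : semi_inner L2 ip := L2_semi_inner mu oOmega.

Let partial (s : R) n (f g : E -> R) : R :=
  \sum_(i < n) (lam i `^ (2 * s)) * (ip f (phi i) * ip g (phi i)).

Let phiL2 i : L2 (phi i).
Proof. by case: heig => _ _ /(_ i) [[[]]]. Qed.

Let partial_semi_inner s n : semi_inner L2 (partial s n).
Proof.
have [h0 hZD ipZ ipC ipge] := L2ip.
apply: (@semi_inner_sum _ _ L2 _ (fun i => lam i `^ (2 * s))) => //.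
  by move=> i; exact: powR_ge0.
move=> i; split => //.
- by move=> a f g k Lf Lg Lk; rewrite ipZ//; ring.
- by move=> f g _ _; rewrite mulrC.
- by move=> f _; rewrite -expr2 sqr_ge0.
Qed.

Let u (s : R) (q : E -> R) (i : nat) : \bar R :=
  (lam i `^ (2 * s) * ip q (phi i) ^+ 2)%:E.

Let u_ge0 s q i : (0 <= u s q i)%E.
Proof. by rewrite lee_fin mulr_ge0 ?powR_ge0 ?sqr_ge0. Qed.

Let partialE s q n : (\sum_(0 <= i < n) u s q i = (partial s n q q)%:E)%E.
Proof.
rewrite big_mkord /partial -sumEFin.
by apply: eq_bigr => i _; rewrite /u expr2.
Qed.

Let sqnorm_ge0 s q : (0 <= Hdot_sqnorm s q)%E.
Proof. by apply: nneseries_ge0 => i _ _; exact: u_ge0. Qed.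

Let partial_le_norm s q n : Hdot s q -> Num.sqrt (partial s n q q) <= Hdot_norm s q.
Proof.
move=> [_ qoo]; rewrite ler_sqrt ?fine_ge0// -lee_fin fineK ?ge0_fin_numE//.
by rewrite -partialE; apply: nneseries_lim_ge => i _ _; exact: u_ge0.
Qed.

Lemma Hdot_norm_le s q b : L2 q -> 0 <= b ->
  (forall n, \sum_(i < n) lam i `^ (2 * s) * ip q (phi i) ^+ 2 <= b ^+ 2) ->
  Hdot s q /\ Hdot_norm s q <= b.
Proof.
move=> Lq b0 H.
have le : (Hdot_sqnorm s q <= (b ^+ 2)%:E)%E.
  apply: lime_le; first by apply: is_cvg_nneseries => i _ _; exact: u_ge0.
  apply: nearW => n; rewrite partialE lee_fin; apply: le_trans (H n).
  by apply: ler_sum => i _; rewrite expr2.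
split; first by split => //; exact: le_lt_trans le (ltry _).
rewrite -[leRHS]ger0_norm// -sqrtr_sqr ler_sqrt ?sqr_ge0//.
by rewrite -lee_fin fineK// ge0_fin_numE//; exact: le_lt_trans le (ltry _).
Qed.

Let Hdot_norm_le' s q b : L2 q -> 0 <= b ->
  (forall n, Num.sqrt (partial s n q q) <= b) -> Hdot s q /\ Hdot_norm s q <= b.
Proof.
move=> Lq b0 H; apply: Hdot_norm_le => // n.
have [_ _ _ _ pge] := partial_semi_inner s n.
by have := H n;
  rewrite -(ler_pXn2r (_ : 0 < 2)%N) ?nnegrE ?sqrtr_ge0// sqr_sqrtr ?pge//.
Qed.

(** The truncated sums come from semi-inner products; their triangle inequality and homogeneity pass
    to the full series as inequalities. Equality in the homogeneity follows by applying the
    inequality to [a^-1] as well. *)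
Lemma Hdot_seminormed s : seminormed (Hdot s) (Hdot_norm s).
Proof.
have pN n := semi_inner_seminormed (partial_semi_inner s n).
have ge0 q : 0 <= Hdot_norm s q by exact: sqrtr_ge0.
have L20 : L2 0 by case: L2ip.
have HZ a q : Hdot s q -> Hdot s (a *: q) /\ Hdot_norm s (a *: q) <= `|a| * Hdot_norm s q.
  move=> Hq; have [Lq _] := Hq; apply: Hdot_norm_le'.
  - exact: (seminZ (pN 0%N)).
  - by rewrite mulr_ge0.
  - by move=> n; rewrite (seminN_Z (pN n))// ler_wpM2l// partial_le_norm.
have HD p q : Hdot s p -> Hdot s q ->
    Hdot s (p + q) /\ Hdot_norm s (p + q) <= Hdot_norm s p + Hdot_norm s q.
  move=> Hp Hq; have [Lp _] := Hp; have [Lq _] := Hq; apply: Hdot_norm_le'.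
  - exact: (seminD (pN 0%N)).
  - by rewrite addr_ge0.
  - move=> n; apply: le_trans (ler_seminD (pN n) Lp Lq) _.
    by rewrite lerD// partial_le_norm.
split => //.
- suff : Hdot s 0 /\ Hdot_norm s 0 <= 0 by case.
  apply: Hdot_norm_le' => // n.
  by rewrite (semin_norm0 (pN n)).
- by move=> a p q Hp Hq; exact: (HD _ _ (HZ a _ Hp).1 Hq).1.
- move=> a q Hq; apply/eqP; rewrite eq_le (HZ _ _ Hq).2/=.
  have [->|a0] := eqVneq a 0; first by rewrite normr0 mul0r.
  have := (HZ a^-1 _ (HZ a _ Hq).1).2; rewrite scalerA mulVf// scale1r.
  by rewrite normfV mulrC ler_pdivlMr ?normr_gt0// mulrC.
- by move=> p q Hp Hq; exact: (HD _ _ Hp Hq).2.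
Qed.

(** The bridge from the energy norm, in which the Galerkin argument runs, to the spectral norm in
    which the error is measured. It also puts the finite element functions into [Hdot 1]. *)
Lemma eig_class_Hdot1 f : eig_class f ->
  Hdot 1 f /\ Hdot_norm 1 f <= Num.sqrt (aform f f).
Proof.
move=> ef; have [Hf _] := ef; have [Lf _] := Hf.
have [_ _ _ _ age] := aform_semi_inner oOmega muO hK heig.
have [lam0 _ _ _ _] := heig.
apply: Hdot_norm_le => // n.
rewrite sqr_sqrtr ?age//.
apply: le_trans (eig_class_bessel oOmega muO hK heig n ef).
by apply: ler_sum => i _; rewrite mulr1 powR_mulrn// ltW.
Qed.

End Hdot.

(** * Weak derivatives under bounded maps *)

Lemma strongly_measurable_superset {R : realType} {V : lmodType R}
    (X X' : set V) (N : V -> R) (D : set R) (f : R -> V) :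
  X `<=` X' -> strongly_measurable X N D f -> strongly_measurable X' N D f.
Proof.
move=> XX' [s sf].
exists (fun n => @SimpleFun R V X' (sf_card (s n)) (@sf_set _ _ _ (s n))
  (@sf_val _ _ _ (s n)) (@sf_measurable _ _ _ (s n))
  (fun i => XX' _ (sf_valP i))).
exact: sf.
Qed.

Lemma quasilinear_weaken {R : realType} {V W : lmodType R} (X : set V)
    (N : V -> R) (Y Y' : set W) (N' N'' : W -> R) (A : V -> W) (C : R) :
  seminormed X N -> seminormed Y N' -> seminormed Y' N'' ->
  Y `<=` Y' -> (forall y, Y y -> N'' y <= N' y) ->
  bounded_quasilinear X N Y N' A C -> bounded_quasilinear X N Y' N'' A C.
Proof.
move=> XN YN YN' YY NN [C0 AY Alin Abd]; split => //.
- by move=> x /AY/YY.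
- move=> a x y Xx Xy; apply/eqP; rewrite eq_le.
  have Yz : Y (A (a *: x + y) - (a *: A x + A y)).
    apply: (seminB YN); first by apply: AY; case: XN => _ + _ _ _; exact.
    by case: YN => _ + _ _ _; apply; exact: AY.
  by rewrite -{1}(Alin a _ _ Xx Xy) NN// (semin_ge0 YN')//; exact: YY.
- by move=> x Xx; apply: le_trans (NN _ (AY _ Xx)) _; exact: Abd.
Qed.

Section PushWeakDeriv.
Context {R : realType} {V W : lmodType R} {X : set V} {N : V -> R}
  {Y : set W} {N' : W -> R} {A : V -> W} {C : R}.
Hypotheses (XN : seminormed X N) (YN : seminormed Y N')
  (AC : bounded_quasilinear X N Y N' A C).

Let AY x : X x -> Y (A x). Proof. by case: AC => _ + _ _; apply. Qed.

Lemma quasilinearZ a x : X x -> N' (a *: A x - A (a *: x)) = 0.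
Proof.
move=> Xx; have X0 := semin0 XN.
have Xax := seminZ XN a Xx.
have YaAx := seminZ YN a (AY Xx).
have A0 : N' (A 0) = 0.
  apply/eqP; rewrite eq_le (semin_ge0 YN (AY X0)) andbT.
  by case: AC => _ _ _ /(_ _ X0); rewrite (semin_norm0 XN) mulr0.
apply/eqP; rewrite eq_le; apply/andP; split; last first.
  by apply: (semin_ge0 YN); apply: (seminB YN) => //; exact: AY.
have Ys : Y (a *: A x + A 0) by apply: (seminD YN) => //; exact: AY.
apply: le_trans (ler_semin_dist YN (y := a *: A x + A 0) YaAx Ys (AY Xax)) _.
rewrite (semin_distC YN Ys (AY Xax)).
case: AC => _ _ /(_ a _ _ Xx X0) + _; rewrite addr0 => ->.
by rewrite opprD addNKr (semin_normN YN) ?A0 ?addr0//; exact: AY.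
Qed.

Lemma bochner_null (D : set R) (f : R -> W) (I J : W) :
  Y J -> N' (I - J) = 0 ->
  is_bochner_integral Y N' D f I -> is_bochner_integral Y N' D f J.
Proof.
move=> YJ IJ [YI [Yf [s [sf sI]]]]; split => //; split => //.
exists s; split => //.
have Ys n := sf_integralP YN D (s n).
apply: (@squeeze_cvgr _ _ _ _ (cst 0) (fun n => N' (sf_integral D (s n) - I))).
- apply: nearW => n; apply/andP; split.
    by apply: (semin_ge0 YN); exact: (seminB YN).
  by apply: le_trans (ler_semin_dist YN (Ys n) YI YJ) _; rewrite IJ addr0.
- exact: cvg_cst.
- exact: sI.
Qed.

(** If [J] is the integral of [psi' f], then [A J] is that of [psi' g], since bounded quasilinear
    maps commute with Bochner integrals; the same map carries the integral of [psi f1]. *)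
Lemma weak_deriv_push (T : R) (B : set R) (f f1 : R -> V) (g g1 : R -> W) :
  measurable B -> lebesgue_measure B = 0%E ->
  (forall t, 0 < t < T -> X (f t)) -> (forall t, 0 < t < T -> X (f1 t)) ->
  (forall t, 0 < t < T -> Y (g t)) -> (forall t, 0 < t < T -> Y (g1 t)) ->
  (forall t, 0 < t < T -> ~ B t -> N' (g t - A (f t)) = 0) ->
  (forall t, 0 < t < T -> ~ B t -> N' (g1 t - A (f1 t)) = 0) ->
  weak_deriv X N T f f1 -> weak_deriv Y N' T g g1.
Proof.
move=> mB B0 Xf Xf1 Yg Yg1 gf gf1 ff1 psi tpsi; have [J [J1 J2]] := ff1 _ tpsi.
have XJ : X J by case: J1.
have null c (t : R) (q : R -> V) (r : R -> W) : X (q t) -> Y (r t) ->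
    N' (r t - A (q t)) = 0 -> N' (c *: r t - A (c *: q t)) = 0.
  move=> Xq Yr rq; have Yc := seminZ YN c Yr; have YA := seminZ YN c (AY Xq).
  have YAc := AY (seminZ XN c Xq).
  apply/eqP; rewrite eq_le (semin_ge0 YN (seminB YN Yc YAc)) andbT.
  apply: le_trans (ler_semin_dist YN Yc YA YAc) _.
  rewrite quasilinearZ// addr0 -scalerBr (seminN_Z YN) ?rq ?mulr0//.
  by apply: (seminB YN) => //; exact: AY.
exists (A J); split.
  apply: (bochner_push XN YN AC mB B0 _ _ J1) => t; rewrite /= in_itv/= => tT.
    by apply: (seminZ YN); exact: Yg.
  by move=> nB; apply: null; [exact: Xf|exact: Yg|exact: gf].
(* Pushing the second integral yields [A (- J)], while the definition asks for [- A J]; the two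
   differ by a null vector. *)
apply: (bochner_null (I := A (- J))).
- by rewrite -scaleN1r; apply: (seminZ YN); exact: AY.
- rewrite -(scaleN1r (A J)) -(scaleN1r J) (semin_distC YN) ?quasilinearZ//.
  + by apply: AY; exact: (seminZ XN).
  + by apply: (seminZ YN); exact: AY.
apply: (bochner_push XN YN AC mB B0 _ _ J2) => t; rewrite /= in_itv/= => tT.
  by apply: (seminZ YN); exact: Yg1.
by move=> nB; apply: null; [exact: Xf1|exact: Yg1|exact: gf1].
Qed.

End PushWeakDeriv.

(** * Volterra equations for Galerkin projections *)

Lemma ae_lebesgue_imply (R : realType) (P Q : R -> Prop) :
  {ae lebesgue_measure, forall t : R, P t} -> (forall t, P t -> Q t) ->
  {ae lebesgue_measure, forall t : R, Q t}.
Proof.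
move=> [A [mA A0 PA]] PQ; exists A; split => // t nQ.
by apply: PA => Pt; apply: nQ; exact: PQ.
Qed.

Lemma ae_lebesgue_imply2 (R : realType) (P P' Q : R -> Prop) :
  {ae lebesgue_measure, forall t : R, P t} ->
  {ae lebesgue_measure, forall t : R, P' t} ->
  (forall t, P t -> P' t -> Q t) -> {ae lebesgue_measure, forall t : R, Q t}.
Proof.
move=> aP aP' PQ.
have F := @ae_filter_ringOfSetsType _ (measurableTypeR R) R lebesgue_measure.
exact: (@filterS2 _ _ F P P' Q PQ aP aP').
Qed.

Lemma ae_lebesgue_foralln (R : realType) (P : nat -> R -> Prop) :
  (forall n, {ae lebesgue_measure, forall t : R, P n t}) ->
  {ae lebesgue_measure, forall t : R, forall n, P n t}.
Proof. exact: (@ae_foralln _ (measurableTypeR R) R lebesgue_measure). Qed.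

Section Galerkin.
Context {R : realType} {V : lmodType R} {X G S : set V} {N : V -> R}
  {B : V -> V -> R} {P : V -> V}.
Hypotheses (XN : seminormed X N) (GB : semi_inner G B)
  (SG : S `<=` G) (XG : X `<=` G) (PS : forall x, X x -> S (P x))
  (PB : forall x chi, X x -> S chi -> B (x - P x) chi = 0).

Local Notation Na := (fun x => Num.sqrt (B x x)).

Let GN : seminormed G Na := semi_inner_seminormed GB.

Let PG x : X x -> G (P x). Proof. by move=> /PS/SG. Qed.

Let BC x y : G x -> G y -> B x y = B y x.
Proof. by case: GB => _ _ _ + _; exact. Qed.

Let BZD a x y z : G x -> G y -> G z -> B (a *: x + y) z = a * B x z + B y z.
Proof. by case: GB => _ _ + _ _; exact. Qed.

Let BB x y z : G x -> G y -> G z -> B (x - y) z = B x z - B y z.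
Proof.
by move=> Gx Gy Gz; rewrite addrC -scaleN1r BZD// mulN1r addrC.
Qed.

Let PB' x chi : X x -> S chi -> B (P x) chi = B x chi.
Proof.
move=> Xx Schi; have := PB Xx Schi.
rewrite (BB (XG Xx) (PG Xx) (SG Schi)) => /eqP.
by rewrite subr_eq0 => /eqP ->.
Qed.

(** [S] is not assumed to be a subspace, so the defect [z] cannot serve as a test vector. It is
    orthogonal to every element of [S], and it is a combination of three of them; expanding one slot
    of [B z z] gives 0. *)
Lemma galerkin_linear_null a x y : X x -> X y ->
  Na (P (a *: x + y) - (a *: P x + P y)) = 0.
Proof.
move=> Xx Xy; have Xxy := seminD XN (seminZ XN a Xx) Xy.
have Gl := seminD GN (seminZ GN a (PG Xx)) (PG Xy).
set z := P _ - _; have Gz : G z by exact: (seminB GN (PG Xxy) Gl).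
have z0 chi : S chi -> B z chi = 0.
  move=> Schi; have Gchi := SG Schi; rewrite /z (BB (PG Xxy) Gl Gchi).
  rewrite (BZD a (PG Xx) (PG Xy) Gchi) !PB'//.
  by rewrite (BZD a (XG Xx) (XG Xy) Gchi) subrr.
suff -> : B z z = 0 by rewrite sqrtr0.
rewrite {2}/z (BC Gz Gz) {1}/z (BB (PG Xxy) Gl Gz) (BZD a (PG Xx) (PG Xy) Gz).
rewrite (BC (PG Xxy) Gz) (BC (PG Xx) Gz) (BC (PG Xy) Gz).
by rewrite !z0 ?mulr0 ?addr0 ?subrr//; exact: PS.
Qed.

Variables (CX CP : R).
Hypotheses (CX0 : 0 < CX) (CP0 : 0 < CP)
  (NaX : forall x, X x -> Na x <= CX * N x)
  (NaP : forall x, X x -> Na (P x) <= CP * N x).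

Lemma galerkin_quasilinear : bounded_quasilinear X N G Na P CP.
Proof. by split => //; exact: galerkin_linear_null. Qed.

Lemma galerkin_error_quasilinear :
  bounded_quasilinear X N G Na (fun x => P x - x) (CP + CX).
Proof.
split => //; first exact: addr_gt0.
- by move=> x Xx; apply: (seminB GN); [exact: PG|exact: XG].
- move=> a x y Xx Xy; have := galerkin_linear_null a Xx Xy.
  rewrite (_ : P _ - _ = P (a *: x + y) - (a *: x + y) -
    (a *: (P x - x) + (P y - y)))//.
  by rewrite scalerBr addrACA -opprD opprB addrA subrK.
- move=> x Xx; have Xx' := XG Xx.
  apply: le_trans (ler_seminD GN (PG Xx) _) _.
    by rewrite -scaleN1r; exact: (seminZ GN).
  by rewrite (semin_normN GN Xx') mulrDl lerD ?NaP ?NaX.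
Qed.

Let form_quasilinear chi : G chi ->
  bounded_quasilinear G Na [set: R^o] Num.norm (B ^~ chi) (Na chi + 1).
Proof.
move=> Gchi; split => //.
- by move=> a x y Gx Gy; rewrite BZD// subrr normr0.
- move=> x Gx; apply: le_trans (semi_inner_CS GB Gx Gchi) _.
  by rewrite mulrC ler_wpM2r ?sqrtr_ge0// lerDl.
Qed.

Let form_integrable (T : R) (f : R -> V) (chi : V) : G chi ->
  L1 G Na `]0, T[ f ->
  lebesgue_measure.-integrable `]0, T[ (EFin \o (fun t => B (f t) chi)).
Proof.
move=> Gchi Lf; have YN := seminormed_norm R.
have [_ sm fin] := L1_push GN YN (form_quasilinear Gchi) Lf.
apply/integrableP; split => //.
apply/measurable_EFinP; apply: strongly_measurable_real => //.
Qed.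

(* Testing with a fixed [chi] turns the Volterra equation into a scalar one, so
   Gronwall applies; the exceptional null set depends on [chi]. *)
Lemma volterra_form_null (T Mk : R) (k : R -> R) (u v : R -> V) (chi : V) :
  0 < T -> 0 < Mk -> (forall t, 0 < t < T -> `|k t| <= Mk) ->
  L1 X N `]0, T[ u -> L1 G Na `]0, T[ v -> S chi ->
  {ae lebesgue_measure, forall t : R, 0 < t < T ->
    B (v t - u t) chi + Rintegral lebesgue_measure `]0, t[
      (fun s => k (t - s) * B (v s - u s) chi) = 0} ->
  {ae lebesgue_measure, forall t : R, 0 < t < T -> B (v t - P (u t)) chi = 0}.
Proof.
move=> T0 Mk0 kM Lu Lv Schi eqn; have Gchi := SG Schi.
have [Xu _ _] := Lu; have [Gv _ _] := Lv.
have Lu' : L1 G Na `]0, T[ (P \o u) by exact: (L1_push XN GN galerkin_quasilinear Lu).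
pose g t := B (v t) chi - B (P (u t)) chi.
(* Galerkin orthogonality of [u t - P (u t)] reduces the equation to one for the scalar function
   [g]. *)
have gE t : 0 < t < T -> B (v t - u t) chi = g t.
  move=> tT; have tD : [set` `]0, T[] t by rewrite /= in_itv.
  by rewrite (BB (Gv _ tD) (XG (Xu _ tD)) Gchi) /g PB'//; exact: Xu.
have ig : lebesgue_measure.-integrable `]0, T[ (EFin \o g).
  exact: (@integrableB _ _ R lebesgue_measure [set` `]0, T[] (measurable_itv _)
    _ _ (form_integrable Gchi Lv) (form_integrable Gchi Lu')).
have /integrableP[mg fg] := ig.
have : {ae lebesgue_measure, forall t : R, 0 < t < T -> `|g t| = 0}.
  apply: (@gronwall_ae0 R T Mk (fun t => `|g t|)) => //.
    by apply: measurableT_comp => //; exact/measurable_EFinP.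
  apply: (ae_lebesgue_imply eqn) => t eqt tT; have /andP[t0 tT'] := tT;
    move: eqt => /(_ tT).
  rewrite gE// => /eqP; rewrite addr_eq0 => /eqP ->; rewrite normrN.
  (* For [s] in []0, t[] the argument [t - s] stays in []0, T[], where the kernel is bounded; the
     value at 0 never enters. *)
  have sub s : [set` `]0, t[] s -> 0 < s < T /\ 0 < t - s < T.
    by rewrite /= in_itv/= => /andP[s0 st]; split; lra.
  apply: normr_Rintegral_le => // [s /sub[sT tsT]|].
    by rewrite normrM gE// ler_wpM2r// kM.
  apply: le_lt_trans fg; apply: ge0_subset_integral => //.
    apply/measurable_EFinP; apply: measurableT_comp => //.
    exact/measurable_EFinP.
  by apply: subset_itvl; rewrite bnd_simp ltW.
move=> /ae_lebesgue_imply; apply => t g0 tT;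
  have tD : [set` `]0, T[] t by rewrite /= in_itv.
have /eqP := g0 tT; rewrite normr_eq0 => /eqP.
by rewrite /g -BB//; [exact: Gv|apply: PG; exact: Xu].
Qed.

(** Orthogonality to the values of the simple functions passes to their limit by Cauchy-Schwarz. *)
Let form_cvg0 (z x : V) (s : nat -> simple_fun G) t : G z -> G x ->
  (fun n => Na (x - sf_eval (s n) t)) @ \oo --> (0 : R) ->
  (forall n i, B z (sf_val (s := s n) i) = 0) -> B z x = 0.
Proof.
move=> Gz Gx sx zs; apply/eqP; rewrite -normr_le0.
have cv : (fun n => Na z * Na (x - sf_eval (s n) t)) @ \oo --> (0 : R).
  by rewrite -(mulr0 (Na z)); apply: cvgM => //; exact: cvg_cst.
apply: (cvgr_to_ge cv); apply: nearW => n.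
have Gs := sf_evalP GN (s n) t.
have zs0 : B (sf_eval (s n) t) z = 0.
  apply: (big_ind (fun y => G y /\ B y z = 0) _ _ _).2.
  - by split; [exact: (semin0 GN)|exact: (semi_inner0 GB)].
  - move=> y y' [Gy y0] [Gy' y'0]; split; first exact: (seminD GN).
    by rewrite (semi_innerD GB)// y0 y'0 addr0.
  - move=> i _; have Gi := sf_valP (s := s n) i; split;
    first exact: (seminZ GN).
    by rewrite (semi_innerZ GB)// BC// zs mulr0.
have -> : B z x = B z (x - sf_eval (s n) t).
  have Gd := seminB GN Gx Gs.
  by rewrite (BC Gz Gd) (BB Gx Gs Gz) zs0 subr0 BC.
by apply: (semi_inner_CS GB) => //; exact: (seminB GN).
Qed.

(* Countably many test vectors suffice, namely the values of simple functions
   approximating [v] and [P u]. *)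
Lemma volterra_galerkin (T Mk : R) (k : R -> R) (u v : R -> V) :
  0 < T -> 0 < Mk -> (forall t, 0 < t < T -> `|k t| <= Mk) ->
  L1 X N `]0, T[ u -> L1 S Na `]0, T[ v ->
  {ae lebesgue_measure, forall t : R, 0 < t < T -> forall chi, S chi ->
    B (v t - u t) chi + Rintegral lebesgue_measure `]0, t[
      (fun s => k (t - s) * B (v s - u s) chi) = 0} ->
  {ae lebesgue_measure, forall t : R, 0 < t < T -> Na (v t - P (u t)) = 0}.
Proof.
move=> T0 Mk0 kM Lu [Sv [s sv] fv] eqn; have [Xu [s' su] _] := Lu.
have Gv t : [set` `]0, T[] t -> G (v t) by move=> /Sv/SG.
have Lv : L1 G Na `]0, T[ v.
  by split => //; apply: (strongly_measurable_superset SG); exists s.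
have null chi : S chi ->
    {ae lebesgue_measure, forall t : R, 0 < t < T -> B (v t - P (u t)) chi = 0}.
  move=> Schi; apply: (volterra_form_null T0 Mk0 kM Lu Lv Schi).
  by apply: (ae_lebesgue_imply eqn) => t + tT; move=> /(_ tT); exact.
have null_seq (c : nat -> nat) (chi : forall n, 'I_(c n) -> V) :
    (forall n i, S (chi n i)) ->
    {ae lebesgue_measure, forall t : R, forall n i, 0 < t < T ->
      B (v t - P (u t)) (chi n i) = 0}.
  move=> Schi.
  (* The index type depends on [n]; natural numbers with a proof of the bound replace it, so that
     countable intersections over [n] and [j] apply. *)
  have : {ae lebesgue_measure, forall t : R, forall n j : nat,
      forall hj : (j < c n)%N, 0 < t < T ->
      B (v t - P (u t)) (chi n (Ordinal hj)) = 0}.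
    apply: ae_lebesgue_foralln => n; apply: ae_lebesgue_foralln => j.
    have [hj|hj] := pselect (j < c n)%N; last first.
      by exists set0; split => // t /= [].
    apply: (ae_lebesgue_imply (null _ (Schi n (Ordinal hj)))) => t H hj' tT.
    by rewrite (bool_irrelevance hj' hj); exact: H.
  move=> /ae_lebesgue_imply; apply => t H n i tT; have := H n i (ltn_ord i) tT.
  by congr (B _ (chi n _) = 0); exact: val_inj.
pose sG n := @SimpleFun R V G (sf_card (s n)) (@sf_set _ _ _ (s n))
  (@sf_val _ _ _ (s n)) (@sf_measurable _ _ _ (s n))
  (fun i => SG (sf_valP i)).
pose sP n := sf_push galerkin_quasilinear (s' n).
have n1 := null_seq _ (fun n => @sf_val _ _ _ (s n)) (fun n i => sf_valP i).
have n2 := null_seq _ (fun n i => P (@sf_val _ _ _ (s' n) i)) (fun n i => PS (sf_valP i)).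
apply: (ae_lebesgue_imply2 n1 n2) => t h1 h2 tT.
have tD : [set` `]0, T[] t by rewrite /= in_itv.
have Gvt := Gv _ tD; have GPut := PG (Xu _ tD).
set w := v t - P (u t); have Gw : G w by exact: (seminB GN).
have wv : B w (v t) = 0.
  apply: (@form_cvg0 w (v t) sG t) => //; first exact: sv.
  by move=> n i; exact: h1.
have wP : B w (P (u t)) = 0.
  apply: (@form_cvg0 w (P (u t)) sP t) => //; last by move=> n i; exact: h2.
  apply: (@squeeze_cvgr _ _ _ _ (cst 0) (fun n => CP * N (u t - sf_eval (s' n) t))).
  - apply: nearW => n; rewrite sqrtr_ge0/=.
    exact: (sf_push_eval XN GN galerkin_quasilinear (s' n) t (Xu _ tD)).
  - exact: cvg_cst.
  - by rewrite -[0](mulr0 CP); apply: cvgM; [exact: cvg_cst|exact: su].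
suff -> : B w w = 0 by rewrite sqrtr0.
by rewrite {1}/w (BB Gvt GPut Gw) (BC Gvt Gw) (BC GPut Gw) wv wP subrr.
Qed.

End Galerkin.

(** * The Ritz-Volterra projection *)

Lemma semi_inner_subset {R : realType} {V : lmodType R} (X Y : set V)
    (B : V -> V -> R) : Y `<=` X -> Y 0 ->
  (forall a x y, Y x -> Y y -> Y (a *: x + y)) ->
  semi_inner X B -> semi_inner Y B.
Proof.
move=> YX Y0 Ylin [_ _ BZ BC Bge]; split => //.
- by move=> a x y z /YX Xx /YX Xy /YX; exact: BZ.
- by move=> x y /YX Xx /YX; exact: BC.
- by move=> x /YX; exact: Bge.
Qed.

Lemma seminormed_subset {R : realType} {V : lmodType R} (X Y : set V)
    (N : V -> R) : Y `<=` X -> Y 0 ->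
  (forall a x y, Y x -> Y y -> Y (a *: x + y)) ->
  seminormed X N -> seminormed Y N.
Proof.
move=> YX Y0 Ylin [_ _ Nge NZ ND]; split => //.
- by move=> x /YX; exact: Nge.
- by move=> a x /YX; exact: NZ.
- by move=> x y /YX Xx /YX; exact: ND.
Qed.

(** The seminorm laws are required on a larger space [Y] because this is used for the finite element
    space, of which only the inclusion in [eig_class] is at hand. *)
Lemma L1_renorm {R : realType} {V : lmodType R} (X Y : set V)
    (N N' : V -> R) (C : R) (D : set R) (f : R -> V) :
  seminormed Y N -> seminormed Y N' -> X `<=` Y -> 0 < C ->
  (forall y, Y y -> N' y <= C * N y) -> L1 X N D f -> L1 X N' D f.
Proof.
move=> YN YN' XY C0 NC [Xf [s sf] fin].
pose sY n := @SimpleFun R V Y (sf_card (s n)) (@sf_set _ _ _ (s n))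
  (@sf_val _ _ _ (s n)) (@sf_measurable _ _ _ (s n))
  (fun i => XY _ (sf_valP i)).
split => //.
  exists s => t Dt; have Yft := XY _ (Xf _ Dt).
  have Yd n : Y (f t - sf_eval (s n) t).
    exact: (seminB YN Yft (sf_evalP YN (sY n) t)).
  apply: (@squeeze_cvgr _ _ _ _ (cst 0) (fun n => C * N (f t - sf_eval (s n) t))).
  - by apply: nearW => n; rewrite (semin_ge0 YN' (Yd n)) NC.
  - exact: cvg_cst.
  - by rewrite -[0](mulr0 C); apply: cvgM; [exact: cvg_cst|exact: sf].
apply: (@le_lt_trans _ _ (C%:E * L1norm N D f)%E).
  rewrite /L1norm; apply: ge0_le_integral_mull => //.
  - by move=> t /Xf/XY Yft; rewrite lee_fin (semin_ge0 YN').
  - by move=> t /Xf/XY Yft; rewrite lee_fin (semin_ge0 YN).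
  - by move=> t /Xf/XY Yft; rewrite -EFinM lee_fin NC.
by apply: lte_mul_pinfty => //; rewrite lee_fin ltW.
Qed.

Section RitzVolterra.
Context {R : realType} {d : nat}.
Local Notation E := 'rV[R]_d.
Variables (mu : {measure set (borel_rV R d) -> \bar R}) (Omega : set E).
Hypotheses (oOmega : open Omega) (muO : (mu Omega < +oo)%E).
Variables (K : R) (lam : nat -> R) (phi : nat -> E -> R).
Hypotheses (hK : 0 < K) (heig : dirichlet_eigenpairs mu Omega K lam phi).
Variables (M : seq 'M[R]_(d.+1, d)) (P : (E -> R) -> (E -> R)).
Hypothesis hP : is_ritz mu Omega K M P.

Local Notation L2norm := (L2norm mu Omega).
Local Notation H1 := (H1 mu Omega).
Local Notation H2 := (H2 mu Omega).
Local Notation H10 := (H10 mu Omega).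
Local Notation H1norm := (H1norm mu Omega).
Local Notation H2norm := (H2norm mu Omega).
Local Notation aform := (aform mu Omega K).
Local Notation Sh := (Sh mu Omega M).
Local Notation Hs := (Hdot mu Omega lam phi).
Local Notation Ns := (Hdot_norm mu Omega lam phi).
Local Notation G := (eig_class mu Omega K lam phi).

Variable CH : R.
Hypotheses (CH0 : 0 < CH) (Hs2P : forall q, Hs 2 q <-> H2 q /\ H10 q)
  (H2_le : forall q, Hs 2 q -> H2norm q <= CH * Ns 2 q).
Variables (Q h : R).
Hypotheses (Q0 : 0 < Q) (h0 : 0 < h)
  (hest : forall q, H2 q -> H10 q ->
     L2norm (q - P q) + h * H1norm (q - P q) <= Q * h ^+ 2 * H2norm q).

Local Notation Na := (fun f => Num.sqrt (aform f f)).

Let GH1 : G `<=` H1. Proof. by move=> f []. Qed.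
Let G0 : G 0 := eig_class0 oOmega muO hK heig.
Let G_lin a f g : G f -> G g -> G (a *: f + g).
Proof. exact: (eig_class_lin oOmega muO hK heig). Qed.
Let Ga : semi_inner G aform :=
  semi_inner_subset GH1 G0 G_lin (aform_semi_inner oOmega muO hK heig).
Let GN : seminormed G Na := semi_inner_seminormed Ga.
Let H1N : seminormed H1 H1norm := H1norm_seminormed oOmega muO heig.
Let GH1N : seminormed G H1norm := seminormed_subset GH1 G0 G_lin H1N.
Let GL2N : seminormed G L2norm.
Proof.
apply: (seminormed_subset _ G0 G_lin
  (semi_inner_seminormed (L2_semi_inner mu oOmega))).
by move=> f /GH1[].
Qed.
Let HsN s : seminormed (Hs s) (Ns s) := Hdot_seminormed oOmega heig s.
Let H10G f : H10 f -> G f. Proof. exact: (H10_eig_class heig). Qed.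
Let HsG : Hs 2 `<=` G. Proof. by move=> q /Hs2P[_ /H10G]. Qed.
Let ShG : Sh `<=` G. Proof. by move=> q [/H10G]. Qed.
Let PSh q : Hs 2 q -> Sh (P q).
Proof. by move=> /Hs2P[_ /hP[]]. Qed.
Let PG q : Hs 2 q -> G (P q). Proof. by move=> /PSh/ShG. Qed.
Let Pa q chi : Hs 2 q -> Sh chi -> aform (q - P q) chi = 0.
Proof. by move=> /Hs2P[_ /hP[_]]; exact. Qed.

Let Na_le f : G f -> Na f <= Num.sqrt K * H1norm f.
Proof. by move=> /GH1; exact: (aform_le_H1norm oOmega hK). Qed.

Definition ritz_error (q : E -> R) := P q - q.
Local Notation A := ritz_error.

Let AG q : Hs 2 q -> G (A q).
Proof. by move=> Hq; exact: (seminB GN (PG Hq) (HsG Hq)). Qed.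

Let ritz_error_le q : Hs 2 q ->
  L2norm (A q) + h * H1norm (A q) <= Q * CH * h ^+ 2 * Ns 2 q.
Proof.
move=> Hq; rewrite /A (semin_distC GL2N (PG Hq) (HsG Hq)).
rewrite (semin_distC GH1N (PG Hq) (HsG Hq)).
have [H2q H10q] := (Hs2P q).1 Hq.
apply: le_trans (hest H2q H10q) _.
apply: (@le_trans _ _ (Q * h ^+ 2 * (CH * Ns 2 q))).
  by rewrite ler_wpM2l ?H2_le// mulr_ge0 ?exprn_ge0//; exact: ltW.
by move: (Ns 2 q) => b; rewrite le_eqVlt; apply/orP; left; apply/eqP; ring.
Qed.

Lemma ritz_error_L2norm q : Hs 2 q -> L2norm (A q) <= Q * CH * h ^+ 2 * Ns 2 q.
Proof.
move=> Hq; apply: le_trans (ritz_error_le Hq).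
by rewrite lerDl mulr_ge0 ?sqrtr_ge0// ltW.
Qed.

Let ritz_error_H1norm q : Hs 2 q -> h * H1norm (A q) <= Q * CH * h ^+ 2 * Ns 2 q.
Proof.
move=> Hq; apply: le_trans (ritz_error_le Hq).
by rewrite lerDr sqrtr_ge0.
Qed.

Let Ns1_le f : G f -> Ns 1 f <= Na f.
Proof. by move=> /(eig_class_Hdot1 oOmega muO hK heig)[]. Qed.

Let GHs1 : G `<=` Hs 1.
Proof. by move=> f /(eig_class_Hdot1 oOmega muO hK heig)[]. Qed.

Let sK0 : 0 < Num.sqrt K. Proof. by rewrite sqrtr_gt0. Qed.

(** The [Hdot 1] norm is at most the energy norm, which is at most [Num.sqrt K] times the H^1
    norm. *)
Lemma ritz_error_Hdot1 q : Hs 2 q ->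
  h * Ns 1 (A q) <= Num.sqrt K * (Q * CH * h ^+ 2) * Ns 2 q.
Proof.
move=> Hq; have GA := AG Hq.
apply: (@le_trans _ _ (Num.sqrt K * (h * H1norm (A q)))).
  rewrite mulrCA ler_wpM2l ?(ltW h0)//.
  by apply: le_trans (Ns1_le GA) _; exact: Na_le.
by rewrite -mulrA ler_wpM2l ?(ltW sK0)// ritz_error_H1norm.
Qed.

(** This constant depends on [h]; it serves to carry measurability, integrability and weak
    derivatives across the Ritz error, and does not enter the final estimate. *)
Let CA := Num.sqrt K * (Q * CH * h).
Let CA0 : 0 < CA. Proof. by rewrite !mulr_gt0. Qed.

Let Na_A q : Hs 2 q -> Na (A q) <= CA * Ns 2 q.
Proof.
move=> Hq; apply: le_trans (Na_le (AG Hq)) _.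
rewrite -mulrA ler_wpM2l ?(ltW sK0)// -(ler_pM2l h0).
apply: le_trans (ritz_error_H1norm Hq) _.
by move: (Ns 2 q) => b; rewrite le_eqVlt; apply/orP; left; apply/eqP; ring.
Qed.

Let CI := Num.sqrt K * CH.
Let CI0 : 0 < CI. Proof. by rewrite mulr_gt0. Qed.

Let Na_Hs2 q : Hs 2 q -> Na q <= CI * Ns 2 q.
Proof.
move=> Hq; apply: le_trans (Na_le (HsG Hq)) _.
rewrite -mulrA ler_wpM2l ?(ltW sK0)//; apply: le_trans (H2_le Hq).
rewrite ler_sqrt ?lerDl; last first.
  rewrite !addr_ge0 ?sqr_ge0// ?sumr_ge0// => i _; first exact: sqr_ge0.
  by rewrite sumr_ge0// => j _; exact: sqr_ge0.
by rewrite sumr_ge0// => i _; rewrite sumr_ge0// => j _; exact: sqr_ge0.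
Qed.

Let Na_P q : Hs 2 q -> Na (P q) <= (CA + CI) * Ns 2 q.
Proof.
move=> Hq; rewrite -(subrK q (P q)).
apply: le_trans (ler_seminD GN (AG Hq) (HsG Hq)) _.
by rewrite mulrDl; apply: lerD; [exact: Na_A|exact: Na_Hs2].
Qed.

Let CAI0 : 0 < CA + CI. Proof. exact: addr_gt0. Qed.

Let A_quasilinear : bounded_quasilinear (Hs 2) (Ns 2) (Hs 1) (Ns 1) A
  (CA + CI + CI).
Proof.
apply: (quasilinear_weaken (HsN 2) GN (HsN 1) GHs1 Ns1_le).
exact: (galerkin_error_quasilinear (HsN 2) Ga ShG HsG PSh Pa CI0 CAI0 Na_Hs2 Na_P).
Qed.

Variables (T Mk : R) (k : R -> R).
Hypotheses (T0 : 0 < T) (Mk0 : 0 < Mk)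
  (kM : forall t, 0 < t < T -> `|k t| <= Mk).

Lemma ritz_volterra_ritz (u v : R -> E -> R) :
  L1 (Hs 2) (Ns 2) `]0, T[ u -> is_ritz_volterra mu Omega K M T k u v ->
  {ae lebesgue_measure, forall t : R, 0 < t < T -> Na (v t - P (u t)) = 0}.
Proof.
move=> Lu [Lv eqn]; have Lv' : L1 Sh Na `]0, T[ v.
  exact: (L1_renorm GH1N GN ShG sK0 Na_le Lv).
exact: (volterra_galerkin (HsN 2) Ga ShG HsG PSh Pa CAI0 Na_P T0 Mk0 kM Lu Lv' eqn).
Qed.

(** The identity [v - u = A \o u] holds off a null set and up to null vectors. Integrability and
    weak derivatives tolerate this, but strong measurability asks for convergence at every time, so
    it is derived from that of [v] and [u] separately. *)
Lemma ritz_volterra_W21 (u u1 u2 v : R -> E -> R) :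
  W21 (Hs 2) (Ns 2) T u u1 u2 -> is_ritz_volterra mu Omega K M T k u v ->
  W21 (Hs 1) (Ns 1) T (fun t => v t - u t) (A \o u1) (A \o u2).
Proof.
move=> [Lu Lu1 Lu2 w1 w2] rv.
have [B [mB B0 vB]] := ritz_volterra_ritz Lu rv.
have [Xu smu finu] := Lu; have [Xu1 _ _] := Lu1; have [Xu2 _ _] := Lu2.
have [Lv _] := rv; have [Sv smv finv] := Lv.
have Gv t : [set` `]0, T[] t -> G (v t) by move=> /Sv/ShG.
have Gu t : [set` `]0, T[] t -> G (u t) by move=> /Xu/HsG.
have in_T t : 0 < t < T -> [set` `]0, T[] t by rewrite /= in_itv.
have Hs1vu t : [set` `]0, T[] t -> Hs 1 (v t - u t).
  by move=> tT; apply: GHs1; exact: (seminB GN (Gv _ tT) (Gu _ tT)).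
have Hs1A q : Hs 2 q -> Hs 1 (A q) by move=> /AG/GHs1.
have vuA t : [set` `]0, T[] t -> ~ B t -> Ns 1 (v t - u t - A (u t)) = 0.
  move=> tT nBt; have tT' : 0 < t < T by move: tT; rewrite /= in_itv.
  have := vB t; rewrite /= => H; have {}H : Na (v t - P (u t)) = 0.
    by apply: contrapT => nz; apply: nBt; apply: H => /(_ tT').
  have -> : v t - u t - A (u t) = v t - P (u t).
    by rewrite /A opprB addrA subrK.
  have Gd := seminB GN (Gv _ tT) (PG (Xu _ tT)).
  apply/le_anti; rewrite (semin_ge0 (HsN 1) (GHs1 Gd)) andbT -H.
  exact: Ns1_le.
split.
- split; first exact: Hs1vu; last first.
    apply: le_lt_trans (L1norm_push_le (HsN 2) (HsN 1) A_quasilinear Xu Hs1vu mB B0 vuA) _.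
    by apply: lte_mul_pinfty => //; rewrite lee_fin ltW// addr_gt0.
  have sGv : strongly_measurable G Na `]0, T[ v.
    by have [_ + _] := L1_renorm GH1N GN ShG sK0 Na_le Lv;
      exact: strongly_measurable_superset.
  have sGu : strongly_measurable G Na `]0, T[ u.
    exact: (strongly_measurable_sub (HsN 2) GN CI0 HsG Na_Hs2 Xu smu).
  apply: (strongly_measurable_sub GN (HsN 1) ltr01 GHs1).
  + by move=> f Gf; rewrite mul1r; exact: Ns1_le.
  + by move=> t tT; exact: (seminB GN (Gv _ tT) (Gu _ tT)).
  + exact: (strongly_measurableB GN Gv Gu sGv sGu).
- exact: (L1_push (HsN 2) (HsN 1) A_quasilinear Lu1).
- exact: (L1_push (HsN 2) (HsN 1) A_quasilinear Lu2).
- apply: (weak_deriv_push (HsN 2) (HsN 1) A_quasilinear mB B0 _ _ _ _ _ _ w1).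
  + by move=> t /in_T/Xu.
  + by move=> t /in_T/Xu1.
  + by move=> t /in_T/Hs1vu.
  + by move=> t /in_T/Xu1/Hs1A.
  + by move=> t /in_T; exact: vuA.
  + by move=> t _ _; rewrite subrr (semin_norm0 (HsN 1)).
- apply: (weak_deriv_push (HsN 2) (HsN 1) A_quasilinear mB B0 _ _ _ _ _ _ w2).
  + by move=> t /in_T/Xu1.
  + by move=> t /in_T/Xu2.
  + by move=> t /in_T/Xu1/Hs1A.
  + by move=> t /in_T/Xu2/Hs1A.
  + by move=> t _ _; rewrite subrr (semin_norm0 (HsN 1)).
  + by move=> t _ _; rewrite subrr (semin_norm0 (HsN 1)).
Qed.

(** The two pointwise bounds are integrated separately and added: the L^2 part contributes 1 and the
    [Hdot 1] part [Num.sqrt K] to the leading factor. *)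
Lemma ritz_error_integral_le (f : R -> E -> R) (D : set R) :
  (forall t, D t -> Hs 2 (f t)) ->
  (L1norm L2norm D (A \o f) + h%:E * L1norm (Ns 1%R) D (A \o f) <=
   ((1 + Num.sqrt K) * (Q * CH) * h ^+ 2)%:E * L1norm (Ns 2%R) D f)%E.
Proof.
move=> Xf; pose I := L1norm (Ns 2%R) D f.
have Hs1A q : Hs 2 q -> Hs 1 (A q) by move=> /AG/GHs1.
have C0 : 0 < Q * CH * h ^+ 2 by rewrite !mulr_gt0// exprn_gt0.
have Ns0 s q : 0 <= Ns s q by exact: sqrtr_ge0.
have I0 : (0 <= I)%E by apply: integral_ge0 => t _; rewrite lee_fin.
have i1 : (L1norm L2norm D (A \o f) <= (Q * CH * h ^+ 2)%:E * I)%E.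
  rewrite /I /L1norm; apply: ge0_le_integral_mull => //.
  - by move=> t _; rewrite lee_fin sqrtr_ge0.
  - by move=> t _; rewrite lee_fin.
  - by move=> t Dt; rewrite -EFinM lee_fin; apply: ritz_error_L2norm; exact: Xf.
have i2 : (L1norm (Ns 1%R) D (A \o f) <=
    (Num.sqrt K * (Q * CH * h ^+ 2) / h)%:E * I)%E.
  rewrite /I /L1norm; apply: ge0_le_integral_mull => //.
  - by rewrite divr_gt0// mulr_gt0.
  - by move=> t _; rewrite lee_fin.
  - by move=> t _; rewrite lee_fin.
  - move=> t Dt; rewrite -EFinM lee_fin mulrAC ler_pdivlMr// mulrC.
    by apply: ritz_error_Hdot1; exact: Xf.
apply: (@le_trans _ _ ((Q * CH * h ^+ 2)%:E * I +
    h%:E * ((Num.sqrt K * (Q * CH * h ^+ 2) / h)%:E * I))%E).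
  by apply: leeD => //; rewrite lee_wpmul2l// lee_fin ltW.
rewrite muleA -EFinM -ge0_muleDl ?lee_fin ?(ltW C0)//; last first.
  by rewrite mulr_ge0 ?(ltW h0)// divr_ge0 ?(ltW h0)// mulr_ge0 ?sqrtr_ge0// ltW.
rewrite -EFinD -/I le_eqVlt; apply/orP; left; apply/eqP; congr (_%:E * _)%E.
by field; rewrite gt_eqF.
Qed.

End RitzVolterra.

Unset Implicit Arguments.
Set Strict Implicit.

Theorem theorem3p3 (R : realType) (d : nat) (hd : (1 <= d <= 3)%N)
  (mu : {measure set (borel_rV R d) -> \bar R}) (hmu : is_lebesgue mu)
  (Omega : set 'rV[R]_d) (hOmega : admissible_domain Omega)
  (K T : R) (hK : 0 < K) (hT : 0 < T)
  (alpha : R -> R) (astar Qstar : R)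
  (halpha : variable_order T alpha astar Qstar)
  (lam : nat -> R) (phi : nat -> 'rV[R]_d -> R)
  (heig : dirichlet_eigenpairs mu Omega K lam phi)
  (hreg : Hdot2_eq_H2_H10 mu Omega lam phi)
  (I : Type) (M : I -> seq 'M[R]_(d.+1, d)) (h : I -> R)
  (hM : quasi_uniform_partitions Omega M h)
  (Rh : I -> ('rV[R]_d -> R) -> ('rV[R]_d -> R))
  (hRh : forall i, is_ritz mu Omega K (M i) (Rh i))
  (hest : ritz_estimate mu Omega h Rh) :
  let Hs s := Hdot mu Omega lam phi s in
  let Ns s := Hdot_norm mu Omega lam phi s in
  exists2 Q : R, 0 < Q &
    forall (i : I) (u u1 u2 v : R -> 'rV[R]_d -> R) (u0 u0' : 'rV[R]_d -> R),
      W21 (Hs 2) (Ns 2) T u u1 u2 ->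
      initial_value (Hs 2) (Ns 2) T u u0 ->
      initial_value (Hs 2) (Ns 2) T u1 u0' ->
      is_ritz_volterra mu Omega K (M i) T (vo_kernel T alpha) u v ->
      exists rho1 rho2 : R -> 'rV[R]_d -> R,
        W21 (Hs 1) (Ns 1) T (fun t => v t - u t) rho1 rho2 /\
        forall t, 0 <= t <= T ->
          let D := [set` `]0, t[] in
          (L1norm (L2norm mu Omega) D rho2 + (h i)%:E * L1norm (Ns 1%R) D rho2
           <= (Q * h i ^+ 2)%:E
              * ((Ns 2 u0 + Ns 2 u0')%R%:E + W21norm (Ns 2%R) t u u1 u2))%E.
Proof.
move=> Hs Ns; case: hOmega => oOmega _ bOmega _ _.
have muO := bounded_measure_fin oOmega hmu bOmega.
have [Mk Mk0 kM] := vo_kernel_bounded hT halpha.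
case: hreg => Hs2P [CH CH0 Hs2_le]; case: hest => Q Q0 hestQ.
case: hM => c [C [_ [_ hM']]].
have C0 : 0 < (1 + Num.sqrt K) * (Q * CH).
  by rewrite !mulr_gt0// ltr_pwDl// sqrtr_ge0.
(* [Q] comes from the Ritz estimate and [CH] from the equivalence of the [Hdot 2] and H^2 norms;
   neither depends on the mesh index [i]. *)
exists ((1 + Num.sqrt K) * (Q * CH)) => // i u u1 u2 v u0 u0' wu _ _ rv.
have hi0 : 0 < h i by case: (hM' i).
have H2_le q : Hs 2 q -> H2norm mu Omega q <= CH * Ns 2 q by move=> /Hs2_le[].
exists (ritz_error (Rh i) \o u1), (ritz_error (Rh i) \o u2); split.
  exact: (ritz_volterra_W21 oOmega muO hK heig (hRh i) CH0 Hs2P H2_le Q0 hi0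
    (hestQ i) hT Mk0 kM wu rv).
move=> t /andP[t0 tT]; cbv zeta; set D := [set` `]0, t[];
  have [_ _ [Xu2 _ _] _ _] := wu.
have Xf s : D s -> Hs 2 (u2 s).
  move=> Ds; apply: Xu2; move: Ds; rewrite /D /= !in_itv/= => /andP[-> st].
  exact: lt_le_trans st tT.
apply: le_trans (ritz_error_integral_le oOmega muO hK heig (hRh i) CH0 Hs2P
  H2_le Q0 hi0 (hestQ i) Xf) _.
(* What has been obtained is a multiple of the norm of [u2] on []0, t[]; the other terms of the
   right-hand side are nonnegative. *)
apply: lee_wpmul2l; first by rewrite lee_fin mulr_ge0 ?exprn_ge0// ltW.
have L0 f : (0 <= L1norm (Ns 2%R) D f)%E.
  by apply: integral_ge0 => s _; rewrite lee_fin sqrtr_ge0.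
apply: (@le_trans _ _ (W21norm (Ns 2) t u u1 u2)).
  by rewrite /W21norm leeDr// adde_ge0// L0.
by rewrite leeDr// lee_fin addr_ge0// sqrtr_ge0.
Qed.
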